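(* Let $\mathbf x\in\mathbb{IA}^*_\infty$ and let $\boldsymbol\theta:\mathbb{Z}_+\times\mathbb{Z}_+\to(0,\infty)$ be an environment, satisfying $\inf\boldsymbol\theta>0$, $\sup\boldsymbol\theta<\infty$ in case (a) below and $\inf\boldsymbol\theta>0$, $\sup\boldsymbol\theta<1$ in cases (b) and (c). Suppose that the process $(\mathsf{X}(t);t\ge0)$ evolves according to one of the following push-block dynamics: (a) continuous-time pure-birth, (b) sequential-update Bernoulli, (c) Warren-Windridge geometric, in environment $\boldsymbol\theta$ with initial condition $\mathsf{X}(0)=\mathbf x$. Then the process $(\mathsf{Hgt}(\mathsf{X}(t));t\ge0)$ follows respectively the push-block dynamics: (a) continuous-time pure-birth, (b) Warren-Windridge geometric, (c) sequential-update Bernoulli, in environment $\hat{\boldsymbol\theta}$, where $\hat{\boldsymbol\theta}(x,y)=\boldsymbol\theta(y,x)$, with initial condition $\mathsf{Hgt}(\mathbf x)$.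
   Context: Levels are labelled from $0$ and coordinates from $0$: level $n$ has $n+1$ particles $x_0^{(n)}<x_1^{(n)}<\dots<x_n^{(n)}$ in $\mathbb{Z}_+=\{0,1,2,\dots\}$. $\mathbb{IA}_\infty$ is the set of arrays $(x_k^{(n)})_{0\le k\le n;\,n\ge0}$ of non-negative integers with consecutive levels interlacing: $x^{(n)}_0\le x^{(n-1)}_0<x^{(n)}_1\le x^{(n-1)}_1<\dots\le x^{(n-1)}_{n-1}<x^{(n)}_n$ for $n\ge1$. $$\mathbb{IA}^*_\infty=\left\{(x_k^{(n)})_{0\le k\le n;\,n\ge0}\in\mathbb{IA}_\infty:\ \forall i\ge1\ \exists j_i<\infty\text{ such that }x_i^{(n)}=i\text{ for }n\ge j_i\right\}.$$ The map $\mathsf{Hgt}:\mathbb{IA}^*_\infty\to\mathbb{IA}^*_\infty$ sends $(x_i^{(j)})_{0\le i\le j;\,j\ge0}$ to $(\mathsf{h}_i(j)+i)_{0\le i\le j;\,j\ge0}$ (the entry with subscript $i$ at level $j$ being $\mathsf{h}_i(j)+i$), where $\mathsf{h}_i(j)=\#\{n\ge i:x_i^{(n)}>j\}$. (The dynamics below started in $\mathbb{IA}^*_\infty$ almost surely stay in $\mathbb{IA}_\infty^*$ for all times.) Dynamics in environment $\boldsymbol\theta$ (first levels autonomous; conventions $\mathsf{X}^{(n-1)}_n=+\infty$, $\mathsf{X}^{(n-1)}_{-1}=-\infty$; all random variables for different particles and different time-steps independent): Continuous-time pure-birth: each particle has an independent exponential clock, of rate $\boldsymbol\theta(x,n)$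 when the particle is at position $x$ at level $n$. When the clock of $\mathsf{X}_i^{(n)}=x$ rings: if $\mathsf{X}_i^{(n-1)}=x$ nothing happens (blocked); otherwise $\mathsf{X}_i^{(n)}$ moves to $x+1$, and if $\mathsf{X}_{i+1}^{(n+1)}=x+1$ it is instantaneously pushed to $x+2$, this pushing being propagated instantaneously to higher levels. Sequential-update Bernoulli (discrete time): with independent $\{0,1\}$-valued $\mathsf{B}_t^{i,(n)}(x)$, $\mathbb{P}(\mathsf{B}^{i,(n)}_t(x)=1)=\boldsymbol\theta(x,n)$, $$\mathsf{X}_i^{(n)}(t+1)=\min\{\mathsf{X}_i^{(n-1)}(t+1),\max\{\mathsf{X}_i^{(n)}(t)+\mathsf{B}_t^{i,(n)}(\mathsf{X}_i^{(n)}(t)),\mathsf{X}_{i-1}^{(n-1)}(t+1)+1\}\}.$$ Warren-Windridge geometric (discrete time): with independent $\mathbb{Z}_+$-valued $\mathsf{G}_t^{i,(n)}(x)$, $\mathbb{P}(\mathsf{G}_t^{i,(n)}(x)=m)=\boldsymbol\theta(x,n)\boldsymbol\theta(x+1,n)\cdots\boldsymbol\theta(x+m-1,n)(1-\boldsymbol\theta(x+m,n))$, and $\mathsf m=\max\{\mathsf{X}_i^{(n)}(t),\mathsf{X}_{i-1}^{(n-1)}(t+1)+1\}$, $$\mathsf{X}_i^{(n)}(t+1)=\min\{\mathsf{X}_i^{(n-1)}(t),\mathsf m+\mathsf{G}_t^{i,(n)}(\mathsf m)\}.$$ *)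

(* Defs.v *)
From mathcomp Require Export all_boot all_order all_algebra finmap.
From mathcomp Require Export all_classical all_reals all_analysis.
Export Order.TTheory GRing.Theory Num.Theory.
Export numFieldNormedType.Exports.

Set Implicit Arguments.
Unset Strict Implicit.
Unset Printing Implicit Defensive.

Local Open Scope classical_set_scope.
Local Open Scope ring_scope.

(* [x n k] is the entry x_k^(n), level first; only the entries with k <= n are
   meaningful, and nothing below depends on the other ones. *)
Definition array := nat -> nat -> nat.

Definition eq_array (x y : array) : Prop :=
  forall n k, (k <= n)%N -> x n k = y n k.

Definition IA (x : array) : Prop :=
  forall n k, (k <= n)%N -> (x n.+1 k <= x n k)%N /\ (x n k < x n.+1 k.+1)%N.

Definition IAstar (x : array) : Prop :=
  IA x /\
  forall i, (1 <= i)%N -> exists j, forall n, (i <= n)%N -> (j <= n)%N -> x n i = i.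

(* [hgt_fun x i j] is h_i(j).  [fset_set] of an infinite set is empty, so the
   value is 0 when the cardinality is infinite; this cannot happen on IAstar. *)
Definition hgt_fun (x : array) (i j : nat) : nat :=
  #|` fset_set [set n | (i <= n)%N /\ (j < x n i)%N]|%fset.

Definition Hgt (x : array) : array := fun j i => (hgt_fun x i j + i)%N.

(* [block y n i v] is min(y_i^(n-1), v) and [push y n i v] is
   max(v, y_(i-1)^(n-1) + 1), with the conventions y_n^(n-1) = +oo and
   y_(-1)^(n-1) = -oo. *)
Definition block (y : array) (n i v : nat) : nat :=
  if (i < n)%N then minn (y n.-1 i) v else v.

Definition push (y : array) (n i v : nat) : nat :=
  if (0 < i)%N then maxn v (y n.-1 i.-1).+1 else v.

(* The configuration after the clock of the particle i of level n has rung in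
   the configuration z.  Unless the particle is blocked, it moves by one
   together with the maximal run (i + l, n + l), 0 <= l, of particles at the
   positions z_i^(n) + l, which are those reached by the pushing. *)
Definition pb_blocked (z : array) (n i : nat) : bool :=
  (i < n)%N && (z n.-1 i == z n i).

Definition pb_moves (z : array) (n i m k : nat) : bool :=
  [&& (n <= m)%N, k == (i + (m - n))%N &
      [forall l : 'I_(m - n).+1, z (n + l)%N (i + l)%N == (z n i + l)%N]].

Definition pb_jump (z : array) (n i : nat) : array :=
  if pb_blocked z n i then z
  else fun m k => if pb_moves z n i m k then (z m k).+1 else z m k.

Definition mutually_independent (R : realType) (d d' : measure_display)
    (T : measurableType d) (E : measurableType d') (P : probability T R)
    (I : choiceType) (xi : I -> {mfun T >-> E}) : Prop :=
  forall (J : {fset I}) (A : I -> set E), (forall i, measurable (A i)) ->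
    (P (\bigcap_(i in [set` J]) (xi i @^-1` A i)) =
     \prod_(i <- J) P (xi i @^-1` A i))%E.

(* A process is indexed by [S] and observed on [D] (all of [S], or the
   nonnegative half-line). *)
Definition measurable_process (S : Type) (D : set S) (d : measure_display)
    (T : measurableType d) (X : S -> T -> array) : Prop :=
  forall t n k, D t -> (k <= n)%N -> measurable_fun setT (fun w => X t w n k).

(* Equality in law: equality of all finite-dimensional distributions.  The
   state space being countable coordinatewise, it suffices to compare the
   probabilities of the cylinders below, which form a pi-system. *)
Definition eq_law (R : realType) (S : Type) (D : set S)
    (d d' : measure_display) (T : measurableType d) (T' : measurableType d')
    (P : probability T R) (X : S -> T -> array)
    (P' : probability T' R) (X' : S -> T' -> array) : Prop :=
  [/\ measurable_process D X, measurable_process D X' &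
   forall (q : nat) (t : 'I_q -> S) (n k v : 'I_q -> nat),
     (forall l, D (t l)) -> (forall l, (k l <= n l)%N) ->
     P [set w | forall l, X (t l) w (n l) (k l) = v l] =
     P' [set w | forall l, X' (t l) w (n l) (k l) = v l]].

Section dynamics.
Context (R : realType).
Implicit Types theta : nat -> nat -> R.

(* [clk (i, n, x, l)], l = 0, 1, ..., are the successive waiting times of the
   clock listened to by the particle i of level n while it is at x.  These
   clocks tick from time 0 on; by absence of memory this is the same as starting
   an exponential clock of rate theta(x,n) when the particle arrives at x, and a
   new one each time it rings while the particle is blocked. *)
Definition exponential_clocks theta (d : measure_display) (T : measurableType d)
    (P : probability T R) (clk : nat * nat * nat * nat -> {RV P >-> R}) : Prop :=
  mutually_independent P clk /\
  forall i n x l (A : set R), measurable A ->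
    distribution P (clk (i, n, x, l)) A = exponential_prob (theta x n) A.

Definition rings_at (clk : nat * nat * nat * nat -> R) (i n x : nat) (t : R) :
    Prop :=
  exists l : nat, t = \sum_(0 <= j < l.+1) clk (i, n, x, j).

Definition left_limit (f : R -> array) (t : R) (z : array) : Prop :=
  forall n k, (k <= n)%N -> \forall s \near t^'-, f s n k = z n k.

(* Right-continuity with left limits, for the product of discrete topologies. *)
Definition cadlag (f : R -> array) : Prop :=
  (forall t n k, 0 <= t -> (k <= n)%N -> \forall s \near t^'+, f s n k = f t n k)
  /\ (forall t, 0 < t -> exists z, left_limit f t z).

Definition pure_birth_path (clk : nat * nat * nat * nat -> R) (x : array)
    (f : R -> array) : Prop :=
  [/\ cadlag f, eq_array (f 0) x &
   forall t z, 0 < t -> left_limit f t z ->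
     (forall n i, (i <= n)%N -> rings_at clk i n (z n i) t ->
        eq_array (f t) (pb_jump z n i)) /\
     ((forall n i, (i <= n)%N -> ~ rings_at clk i n (z n i) t) ->
        eq_array (f t) z)].

(* In the following definitions "X follows the dynamics" is a statement about
   its law: the driving variables may live on another probability space. *)

Definition pure_birth theta (x : array) (d : measure_display)
    (T : measurableType d) (P : probability T R) (X : R -> T -> array) : Prop :=
  {ae P, forall w, cadlag (X ^~ w)} /\
  exists (d' : measure_display) (T' : measurableType d') (P' : probability T' R)
      (clk : nat * nat * nat * nat -> {RV P' >-> R}) (Y : R -> T' -> array),
    [/\ exponential_clocks theta clk,
        {ae P', forall w, pure_birth_path (fun a => clk a w) x (Y ^~ w)} &
        eq_law [set t : R | 0 <= t] P X P' Y].

(* The variable B_t^(i,(n))(x) is [B (t, i, n, x)], and similarly for G. *)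
Definition sequential_bernoulli theta (x : array) (d : measure_display)
    (T : measurableType d) (P : probability T R) (X : nat -> T -> array) : Prop :=
  exists (d' : measure_display) (T' : measurableType d') (P' : probability T' R)
      (B : nat * nat * nat * nat -> {RV P' >-> bool}) (Y : nat -> T' -> array),
    [/\ mutually_independent P' B,
        forall t i n p, P' [set w | B (t, i, n, p) w = true] = (theta p n)%:E,
        forall w, eq_array (Y 0%N w) x,
        forall w t n i, (i <= n)%N ->
          Y t.+1 w n i =
          block (Y t.+1 w) n i
            (push (Y t.+1 w) n i (Y t w n i + B (t, i, n, Y t w n i) w)%N) &
        eq_law [set: nat] P X P' Y].

Definition warren_windridge_geometric theta (x : array) (d : measure_display)
    (T : measurableType d) (P : probability T R) (X : nat -> T -> array) : Prop :=
  exists (d' : measure_display) (T' : measurableType d') (P' : probability T' R)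
      (G : nat * nat * nat * nat -> {RV P' >-> nat}) (Y : nat -> T' -> array),
    [/\ mutually_independent P' G,
        forall t i n p m, P' [set w | G (t, i, n, p) w = m] =
          ((\prod_(0 <= l < m) theta (p + l)%N n) * (1 - theta (p + m)%N n))%:E,
        forall w, eq_array (Y 0%N w) x,
        forall w t n i, (i <= n)%N ->
          let m := push (Y t.+1 w) n i (Y t w n i) in
          Y t.+1 w n i = block (Y t w) n i (m + G (t, i, n, m) w)%N &
        eq_law [set: nat] P X P' Y].

Definition env_inf theta : \bar R := ereal_inf (range (fun a => (theta a.1 a.2)%:E)).
Definition env_sup theta : \bar R := ereal_sup (range (fun a => (theta a.1 a.2)%:E)).

Definition env_swap theta : nat -> nat -> R := fun x y => theta y x.

End dynamics.

(* Main.v *)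
(* On arrays of IA*, the height map is characterized by the Galois-type
   equivalence [n < Hgt z j i <-> j < z n i], hence it is an involution that
   exchanges levels and positions.

   (a) A move of the particle [i] at level [n] from [p] to [p + 1] is a move of
   the dual particle [i] at level [p] from [n] to [n + 1], and blocked moves are
   ignored on both sides; so [Hgt] of a path driven by the clocks
   [clk (i, n, p, l)] is a path driven by [clk (i, p, n, l)], as soon as no two
   clocks ring simultaneously and the path stays in IA*.

   (b) A step of [Hgt X] satisfies the geometric recursion in which the variable
   attached to [(t, i, n, p)] is the length of the run of ones of the Bernoulli
   variables at the site [n] and at the levels [p], [p + 1], etc.  Runs with the
   same [(t, i, n)] are dependent, but the recursion uses only one of them, and
   its law depends only on the joint laws of the variables at distinct
   [(t, i, n)]; these are the same as for independent geometric variables.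

   (c) follows from (b) for the swapped environment, uniqueness in law of the
   geometric dynamics, and the involutivity of [Hgt]. *)

From mathcomp Require Import zify ring.
From mathcomp Require Import measurable_realfun.
Require Import Defs.

Set Implicit Arguments.
Unset Strict Implicit.
Unset Printing Implicit Defensive.

Local Open Scope classical_set_scope.
Local Open Scope ring_scope.

(** * Height functions of interlacing arrays *)

(** The drivers of a process may live on another probability space, so the pathwise duality is
    applied to an auxiliary process [Y] and only its law is carried back. The recursions are
    demanded for every outcome whereas duality holds almost surely; in discrete time the dual
    process is therefore rebuilt by its own recursion and compared with [Hgt Y] up to null sets.

    [IA*] is preserved because of far diagonals: the particles [(n + l, l)], [l <= i], of a
    stabilized configuration can be pushed only by one another, so they stay put if none of them
    tries to move. For one diagonal this has probability bounded below thanks to the bound on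
    [theta], and disjoint diagonals are independent, so one of them is almost surely frozen.

    Independent geometric variables need no new space: relabelled Bernoulli variables of the given
    family supply them.

    In continuous time infinitely many particles may jump in any interval. Induction over jumps is
    replaced by real induction on finitely many levels, and passing to limits under [Hgt], which
    reads infinitely many levels, needs a dominating configuration of [IA*]. *)

Lemma IA_level_lt (z : array) : IA z ->
  forall n k, (k < n)%N -> (z n k < z n k.+1)%N.
Proof.
move=> hz [//|n] k kn.
by have [h1 _] := hz n k kn; have [_ h2] := hz n k kn; exact: leq_ltn_trans h2.
Qed.

Lemma IA_ge (z : array) : IA z -> forall n k, (k <= n)%N -> (k <= z n k)%N.
Proof.
move=> hz n; elim=> [//|k ih] kn.
by apply: leq_ltn_trans (IA_level_lt hz kn); apply: ih; exact: ltnW.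
Qed.

Lemma IA_mono (z : array) : IA z ->
  forall k n m, (k <= n)%N -> (n <= m)%N -> (z m k <= z n k)%N.
Proof.
move=> hz k n m kn; elim: m => [|m ih]; first by rewrite leqn0 => /eqP <-.
rewrite leq_eqVlt => /predU1P[-> //|]; rewrite ltnS => nm.
have [h _] := hz m k (leq_trans kn nm).
exact: leq_trans h (ih nm).
Qed.

Lemma IAstar_stable (z : array) : IAstar z ->
  forall i, exists2 N, (i <= N)%N & forall n, (N <= n)%N -> z n i = i.
Proof.
move=> [hz hs] [|i].
  (* The definition constrains only [i >= 1]; coordinate 0 is squeezed to 0 by coordinate 1 of the
     next level, which equals 1. *)
  have [j hj] := hs 1%N isT; exists j.+1 => // n jn.
  have [_] := hz n 0%N isT.
  by rewrite hj ?ltnS ?(ltnW (leq_trans jn _))// leqn0 => /eqP.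
have [j hj] := hs i.+1 isT; exists (maxn j i.+1) => [|n]; rewrite ?leq_maxr//.
by rewrite geq_max => /andP[jn i_n]; exact: hj.
Qed.

Lemma IAstar_stable_upto (z : array) i : IAstar z ->
  exists N, forall l n, (l <= i)%N -> (N <= n)%N -> z n l = l.
Proof.
move=> hz; elim: i => [|i [N hN]].
  have [N _ hN] := IAstar_stable hz 0; exists N => l n.
  by rewrite leqn0 => /eqP ->; exact: hN.
have [N' _ hN'] := IAstar_stable hz i.+1; exists (maxn N N') => l n.
rewrite geq_max leq_eqVlt ltnS => /predU1P[->|li] /andP[Nn N'n]; first exact: hN'.
exact: hN.
Qed.

(** Coordinate [i] weakly decreases with the level and is at least [i], so once it reaches [i] it
    remains there. *)
Lemma IAstarP (z : array) : IA z ->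
  (forall i, exists2 n, (i <= n)%N & z n i = i) -> IAstar z.
Proof.
move=> hz h; split=> // i _; have [j ij zj] := h i; exists j => n i_n jn.
apply/eqP; rewrite eqn_leq IA_ge// andbT -[leqRHS]zj.
exact: IA_mono.
Qed.

Lemma Hgt_eq (x : array) i j a : (i <= a)%N ->
  (forall n, (i <= n)%N -> (n < a)%N = (j < x n i)%N) -> Hgt x j i = a.
Proof.
move=> ia h; rewrite /Hgt /hgt_fun.
have -> : [set n | (i <= n)%N /\ (j < x n i)%N] = [set` [fset n in iota i (a - i)]%fset].
  apply/seteqP; split => n /=; rewrite !inE/= mem_iota subnKC//.
    by move=> [i_n]; rewrite -h// i_n.
  by move=> /andP[i_n]; rewrite h.
rewrite set_fsetK card_fseq undup_id ?iota_uniq// size_iota.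
by rewrite subnK.
Qed.

(** By monotonicity in the level, the counted levels form a segment starting at [i]; it is finite
    since the coordinate ends at [i <= j]. Adding [i] to its length gives its end. *)
Lemma HgtP (z : array) : IAstar z -> forall i j n, (i <= j)%N -> (i <= n)%N ->
  (n < Hgt z j i)%N = (j < z n i)%N.
Proof.
move=> hz i j n ij i_n.
have [N iN hN] := IAstar_stable hz i.
have ex : exists a, (i <= a)%N && (z a i <= j)%N by exists N; rewrite iN hN.
have [a /andP[ia za] amin] := ex_minnP ex.
have H m : (i <= m)%N -> (m < a)%N = (j < z m i)%N.
  move=> im; apply/idP/idP.
    by apply: contraTT; rewrite -!leqNgt => zm; apply: amin; rewrite im.
  apply: contraTT; rewrite -!leqNgt => am; apply: leq_trans za.
  by apply: IA_mono => //; case: hz.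
by rewrite (Hgt_eq ia H) H.
Qed.

Lemma Hgt_ge (x : array) i j : (i <= Hgt x j i)%N.
Proof. exact: leq_addl. Qed.

Lemma Hgt_eq_array (x y : array) : eq_array x y ->
  forall n k, Hgt x n k = Hgt y n k.
Proof.
move=> xy n k; rewrite /Hgt /hgt_fun; congr (_ + _)%N; congr (#|` fset_set _|%fset).
apply/seteqP; split => m /= [km]; rewrite xy//.
Qed.

Lemma HgtK (z : array) : IAstar z -> eq_array (Hgt (Hgt z)) z.
Proof.
move=> hz n k kn; apply: Hgt_eq; first by case: hz => hz _; exact: IA_ge.
by move=> m km; rewrite HgtP.
Qed.

Lemma IAstar_Hgt (z : array) : IAstar z -> IAstar (Hgt z).
Proof.
move=> hz; have [h1 _] := hz; apply: IAstarP.
  move=> n k kn; split.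
    rewrite leqNgt; apply/negP; rewrite HgtP// ?Hgt_ge//; last exact: leqW.
    by move=> /ltnW; rewrite -HgtP// ?Hgt_ge// ltnn.
  set a := Hgt z n.+1 k.+1.
  have ka : (k.+1 <= a)%N by exact: Hgt_ge.
  have za : (z a k.+1 <= n.+1)%N by rewrite leqNgt -HgtP// ltnn.
  have a0 : (0 < a)%N by lia.
  have kna : (k <= a.-1)%N by lia.
  have [_] := h1 a.-1 k kna; rewrite prednK// => h.
  have := leq_trans h za; rewrite ltnS leqNgt -HgtP//.
  by rewrite -leqNgt; lia.
(* Coordinate [i] is largest at its first level [i], so nothing is counted at the dual level
   [z i i]. *)
move=> i; have := IA_ge h1 (leqnn i); exists (z i i) => //.
by apply: Hgt_eq => // n i_n; rewrite !ltnNge i_n (IA_mono h1 _ i_n).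
Qed.

(** * One sequential Bernoulli step under the height map *)

Lemma seq_step_le (y y' : array) (b : nat -> nat -> nat -> bool) : IA y ->
  (forall n i, (i <= n)%N ->
    y' n i = block y' n i (push y' n i (y n i + b i n (y n i))%N)) ->
  forall n i, (i <= n)%N -> (y' n i <= y n.+1 i.+1)%N.
Proof.
move=> hy hy' n; elim: n => [|n ih] [|i] // i_n; rewrite hy' // /block /push /=.
- by have [_] := hy 0%N 0%N isT; case: (b _ _ _) => /=; lia.
- rewrite geq_min; apply/orP; right.
  by have [_] := hy n.+1 0%N isT; case: (b _ _ _) => /=; lia.
(* By induction the pushing neighbour ends no further than the old position of the pushed particle,
   so a push, like a Bernoulli jump, has length at most one. *)
have [_ h1] := hy n.+1 i.+1 i_n; have := ih i i_n.
by case: (b _ _ _); case: ifP => _ /=; lia.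
Qed.

(** The proposed positions [v] are arbitrary, since [push] and [block] enforce interlacing by
    themselves. Their only possible conflict, a block below a push, is excluded by induction on the
    level. *)
Lemma seq_step_IA (y' : array) (v : nat -> nat -> nat) :
  (forall n i, (i <= n)%N -> y' n i = block y' n i (push y' n i (v n i))) ->
  IA y'.
Proof.
move=> hy' n k kn.
split; first by rewrite hy' ?leqW// /block ltnS kn geq_minl.
elim: n k kn => [|n ih] k kn; rewrite [ltnRHS]hy'// /block /push /=.
  by case: k kn => //= _; rewrite leq_max leqnn orbT.
rewrite ltnS; case: ifP => [k_n|_]; last by rewrite leq_max ltnSn orbT.
rewrite leq_min leq_max ltnSn orbT andbT.
apply: leq_ltn_trans (ih k _); last exact: k_n.
by rewrite hy'// /block k_n geq_minl.
Qed.

(* As [n] grows, [j < y' n i] holds up to the pushed position [m], and then as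
   long as [j <= y n i] and the Bernoulli variables at the site [j] equal one. *)
Lemma seq_step_Hgt (y y' : array) (b : nat -> nat -> nat -> bool) :
  IAstar y -> IAstar y' ->
  (forall n i, (i <= n)%N ->
    y' n i = block y' n i (push y' n i (y n i + b i n (y n i))%N)) ->
  forall j i r, (i <= j)%N ->
  let m := push (Hgt y') j i (Hgt y j i) in
  (forall l, (l < r)%N -> b i (m + l)%N j) -> ~~ b i (m + r)%N j ->
  Hgt y' j i = block (Hgt y) j i (m + r)%N.
Proof.
move=> hy hys' hy' j i r ij m hr1 hr2.
have [hyIA _] := hy.
have hle := seq_step_le hyIA hy'.
have im : (i <= m)%N.
  by rewrite /m /push; case: ifP => _; rewrite ?leq_max Hgt_ge.
(* Below the pushed position, the particle is beyond [j] before the step or is forced beyond [j] by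
   its new lower neighbour. *)
have mP n : (i <= n)%N -> (n < m)%N =
    (j < y n i)%N || ((0 < i)%N && (j <= y' n.-1 i.-1)%N).
  move=> i_n; rewrite /m /push; case: posnP => [i0|i0] /=.
    by rewrite orbF HgtP.
  rewrite leq_max HgtP//; congr orb.
  have -> : (n < (Hgt y' j.-1 i.-1).+1)%N = (n.-1 < Hgt y' j.-1 i.-1)%N by lia.
  by rewrite HgtP//; lia.
(* Dual blocking reads [j <= y n i]: with moves of length at most one, only such a particle can get
   beyond [j]. For [i = j] there is no dual block and the inequality is automatic. *)
have bP n : (i <= n)%N -> (n < block (Hgt y) j i (m + r))%N =
    (j <= y n i)%N && (n < m + r)%N.
  move=> i_n; rewrite /block; case: (ltnP i j) => [lij|ji].
    by rewrite leq_min HgtP//; lia.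
  have -> : i = j by lia.
  by rewrite (IA_ge hyIA)//; lia.
apply: Hgt_eq => [|n i_n].
  rewrite /block; case: ifP => _; rewrite ?leq_min ?Hgt_ge/=;
  exact: leq_trans im (leq_addr _ _).
rewrite bP//.
elim: n i_n => [|n ih] i_n.
  have i0 : i = 0%N by lia.
  subst i; rewrite hy'// /block /push /=.
  have := mP 0%N isT; rewrite /= orbF => m0.
  have [le1|lt1] := leqP j (y 0%N 0%N) => /=; last by case: (b _ _ _); lia.
  have [jy|yj] := ltnP j (y 0%N 0%N); first by lia.
  have yE : y 0%N 0%N = j by lia.
  rewrite yE ltnn in m0; have mE : m = 0%N by lia.
  rewrite yE; case: r hr1 hr2 {bP} => [|r] hr1 hr2.
    by rewrite mE in hr2; rewrite (negbTE hr2); lia.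
  by have := hr1 0%N isT; rewrite mE => -> /=; lia.
have yL : y' n.+1 i = (if (i <= n)%N then minn (y' n i) else id)
    (push y' n.+1 i (y n.+1 i + b i n.+1 (y n.+1 i))%N).
  by rewrite hy' // /block ltnS /=; case: ifP.
have pushP : (j < push y' n.+1 i (y n.+1 i + b i n.+1 (y n.+1 i)))%N =
   (j < y n.+1 i + b i n.+1 (y n.+1 i))%N ||
   ((0 < i)%N && (j <= y' n i.-1)%N).
  by rewrite /push; case: posnP => i0 /=; rewrite ?orbF// leq_max ltnS.
have pushle : (0 < i)%N && (j <= y' n i.-1)%N -> (j <= y n.+1 i)%N.
  move=> /andP[i0 h]; apply: leq_trans h _.
  by rewrite -{2}(prednK i0); apply: hle; lia.
have yn : (i <= n)%N -> (y n.+1 i <= y n i)%N.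
  by move=> h; have [] := hyIA n i h.
have mn := mP n.+1 i_n; rewrite /= in mn.
have core : (j < y' n.+1 i)%N = ((i <= n)%N ==> (j < y' n i)%N) &&
    ((j < y n.+1 i + b i n.+1 (y n.+1 i))%N || ((0 < i)%N && (j <= y' n i.-1)%N)).
  by rewrite yL -pushP; case: ifP => //= _; rewrite leq_min.
rewrite core; apply/idP/idP => /andP[].
  move=> nr jy; rewrite ?jy ?nr.
  apply/andP; split.
    by apply/implyP => i_n'; rewrite -ih//; have := yn i_n'; lia.
  have [nm|mn'] := ltnP n.+1 m.
    rewrite nm in mn; case/orP: (esym mn) => [h|->]; last by rewrite orbT.
    by apply/orP; left; lia.
  have [h|h] := ltnP j (y n.+1 i); first by apply/orP; left; lia.
  have yE : y n.+1 i = j by lia.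
  have := hr1 (n.+1 - m)%N; rewrite subnKC// yE => ->; lia.
move=> /implyP hi ho.
have jy : (j <= y n.+1 i)%N.
  by case/orP: ho => [|/pushle//]; case: (b _ _ _); lia.
rewrite jy /=.
have [nm|mn'] := ltnP n.+1 m; first by lia.
have /norP[h1 h2] : ~~ ((j < y n.+1 i)%N || ((0 < i)%N && (j <= y' n i.-1)%N)).
  by rewrite -mn; lia.
rewrite (negbTE h2) orbF in ho.
have yE : y n.+1 i = j by lia.
have bt : b i n.+1 j by move: ho; rewrite yE; case: (b _ _ _) => //; lia.
rewrite ltnNge leq_eqVlt; apply/norP; split.
  by apply/eqP => e; rewrite e bt in hr2.
(* Above the failure at level [m + r], blocking by the level below keeps the particle from passing
   [j]. *)
apply/negP => mrn.
have i_n' : (i <= n)%N by lia.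
by have := hi i_n'; rewrite -ih//; lia.
Qed.

(** * Jumps and pushed runs of the pure-birth dynamics *)

Lemma pb_movesP (z : array) n i m k :
  reflect (exists L, [/\ m = (n + L)%N, k = (i + L)%N &
      forall l, (l <= L)%N -> z (n + l)%N (i + l)%N = (z n i + l)%N])
    (pb_moves z n i m k).
Proof.
apply: (iffP and3P) => [[nm /eqP kE /forallP h]|[L [-> -> h]]].
  exists (m - n)%N; split; [lia|done|] => l lL.
  have lm : (l < (m - n).+1)%N by rewrite ltnS.
  by have /eqP := h (Ordinal lm).
split; [lia|by apply/eqP; lia|].
by apply/forallP => -[l /= hl]; rewrite h//; lia.
Qed.

(** Near a given time a path agrees with its one-sided limit on finitely many levels at once only,
    so real induction must be run on truncations. *)
Definition IA_upto N (z : array) := forall n k, (n < N)%N -> (k <= n)%N ->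
  (z n.+1 k <= z n k)%N /\ (z n k < z n.+1 k.+1)%N.

Lemma IA_uptoP (z : array) : IA z <-> forall N, IA_upto N z.
Proof.
split=> [h N n k _|h n k]; first exact: h.
exact: (h n.+1).
Qed.

(** If the initiator of a run is not blocked, no pushed particle is: the strict gap to the blocking
    neighbour propagates along the diagonal. *)
Lemma IA_upto_run N (z : array) n i L : IA_upto N z -> (n + L <= N)%N ->
  (i < n)%N -> (z n i < z n.-1 i)%N ->
  forall l, (l <= L)%N -> (z n i + l < z (n + l).-1 (i + l))%N.
Proof.
move=> hz nLN i_n ub; elim=> [|l ih] lL; first by rewrite !addn0.
have hl := ih (ltnW lL); rewrite !addnS /=.
have := hz (n + l).-1 (i + l)%N; rewrite prednK; last by lia.
by case; [lia|lia|] => _; lia.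
Qed.

Lemma IA_upto_unblocked N (z : array) n i : IA_upto N z -> (n <= N)%N ->
  (i < n)%N -> ~~ pb_blocked z n i -> (z n i < z n.-1 i)%N.
Proof.
move=> hz nN i_n; rewrite /pb_blocked i_n /= ltn_neqAle eq_sym => -> /=.
by have := hz n.-1 i; rewrite prednK; [case; [lia|lia|]|lia].
Qed.

Lemma leq_pb_jump (z : array) n i m k : (z m k <= pb_jump z n i m k)%N.
Proof. by rewrite /pb_jump; case: ifP => // _; case: ifP. Qed.

Lemma pb_jump_eq_array (x y : array) n i : (i <= n)%N -> eq_array x y ->
  eq_array (pb_jump x n i) (pb_jump y n i).
Proof.
move=> i_n xy m k km; rewrite /pb_jump.
have -> : pb_blocked x n i = pb_blocked y n i.
  rewrite /pb_blocked; case: ltnP => //= h.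
  by rewrite !xy// -ltnS prednK// (leq_ltn_trans _ h).
case: ifP => _; first exact: xy.
have -> : pb_moves x n i m k = pb_moves y n i m k.
  by apply/pb_movesP/pb_movesP => -[L [mE kE h]]; exists L; split=> // l lL;
    move: (h l lL); rewrite !xy ?leq_add2r.
by rewrite xy.
Qed.

Lemma pb_jump_IA_upto N (z : array) n i : (i <= n)%N -> IA_upto N z ->
  IA_upto N (pb_jump z n i).
Proof.
move=> i_n hz m k mN km; rewrite /pb_jump.
case: ifPn => [_|ub]; first exact: hz.
have [h1 h2] := hz m k mN km; split.
  have [mv|_] := ifPn; last by case: ifP => _; lia.
  case: ifP => [_|nmv]; first by lia.
  move/pb_movesP : mv => [L [mE kE h]].
  have i_ltn : (i < n)%N by lia.
  have nN : (n + L <= N)%N by lia.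
  have ubz : (z n i < z n.-1 i)%N by apply: (IA_upto_unblocked hz) => //; lia.
  have := IA_upto_run hz nN i_ltn ubz (leqnn L).
  by rewrite -mE /= -kE -(h L (leqnn _)) -mE -kE.
have [mv|_] := ifPn (pb_moves z n i m k); last by case: ifP => _; lia.
case: ifPn => [_|]; first by lia.
move/pb_movesP : mv => [L [mE kE h]] nmv.
(* A particle directly in front of a moving one would belong to the run itself. *)
rewrite ltn_neqAle h2 andbT; apply: contra nmv => /eqP e.
apply/pb_movesP; exists L.+1; split; [lia|lia|] => l.
rewrite leq_eqVlt ltnS => /predU1P[->|]; last exact: h.
by rewrite !addnS -mE -kE -e mE kE h.
Qed.

(** A run and its dual are one diagonal with levels and positions exchanged. The position of each
    particle bounds the dual one from above; the strict gap left by an unblocked run bounds it from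
    below. *)
Lemma Hgt_run (z : array) p i L : IAstar z -> (i <= p)%N ->
  ~~ pb_blocked z p i ->
  (forall l, (l <= L)%N -> z (p + l)%N (i + l)%N = (z p i + l)%N) ->
  forall l, (l <= L)%N -> Hgt z (z p i + l)%N (i + l)%N = (p + l)%N.
Proof.
move=> hz ip ub h l lL; have [hIA _] := hz.
have in_ : (i <= z p i)%N by exact: IA_ge.
apply/eqP; rewrite eqn_leq leqNgt HgtP ?leq_add2r// h// ltnn /=.
have [->|i_ltp] := eqVneq i p; first by rewrite Hgt_ge.
have i_p : (i < p)%N by lia.
have zN := (iffLR (IA_uptoP z) hIA (p + L)%N).
have ubz : (z p i < z p.-1 i)%N by apply: (IA_upto_unblocked zN) => //; lia.
have := IA_upto_run zN (leqnn _) i_p ubz lL.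
by rewrite -HgtP ?leq_add2r//; lia.
Qed.

(** Being unblocked means that [p] is the first level at which coordinate [i] is at most [z p i]; a
    blocked particle is not seen by its dual. *)
Lemma Hgt_unblocked (z : array) p i : IAstar z -> (i <= p)%N ->
  ~~ pb_blocked z p i ->
  Hgt z (z p i) i = p /\ ~~ pb_blocked (Hgt z) (z p i) i.
Proof.
move=> hz ip ub; have [hIA _] := hz.
have E : Hgt z (z p i) i = p.
  have := @Hgt_run z p i 0 hz ip ub _ 0 (leqnn _); rewrite !addn0; apply.
  by case=> [|//] _; rewrite !addn0.
split=> //; rewrite /pb_blocked E; apply/negP => /andP[lt /eqP e].
have : (p < Hgt z (z p i).-1 i)%N by rewrite HgtP//; lia.
by rewrite e ltnn.
Qed.

Lemma Hgt_pb_jump (z : array) p i : IAstar z -> (i <= p)%N ->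
  ~~ pb_blocked z p i ->
  eq_array (Hgt (pb_jump z p i)) (pb_jump (Hgt z) (z p i) i).
Proof.
move=> hz ip ub m k km.
have [E ub'] := Hgt_unblocked hz ip ub.
have i_n : (i <= z p i)%N by apply: IA_ge => //; case: hz.
have K := HgtK hz.
rewrite /pb_jump (negbTE ub) (negbTE ub').
apply: Hgt_eq => [|q kq].
  by case: ifP => _; rewrite ?leqW ?Hgt_ge.
have [/pb_movesP[L [mE kE hL]]|nmv] := ifPn (pb_moves (Hgt z) _ _ m k).
  have hL' l : (l <= L)%N -> z (p + l)%N (i + l)%N = (z p i + l)%N.
    move=> lL; have := Hgt_run (IAstar_Hgt hz) i_n ub' hL lL.
    by rewrite E K// leq_add2r.
  have zE : z (p + L)%N k = m by rewrite kE hL'.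
  rewrite mE kE hL// E -kE -mE ltnS leq_eqVlt.
  (* Within the run the subscript determines the level, so the jump alters coordinate [k] at level
     [p + L] only. *)
  have [->|qne] /= := eqVneq q (p + L)%N.
    rewrite ifT; last by apply/pb_movesP; exists L; split.
    by rewrite zE ltnSn.
  rewrite ifF; last first.
    by apply/negP => /pb_movesP[L' [qE kE' _]]; move: qne; rewrite qE; lia.
  rewrite -(HgtP hz km kq); congr (_ < _)%N.
  by rewrite mE kE hL// E.
rewrite HgtP//; case: ifP => // /pb_movesP[L [qE kE hL]].
(* A move changes the comparison with [m] only if it starts at [m], but then the dual particle would
   be in the dual run. *)
rewrite ltnS [RHS]leq_eqVlt; case: eqVneq => //= e; exfalso.
move/negP : nmv; apply; apply/pb_movesP; exists L; split=> //.
  by rewrite e qE kE hL.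
by move=> l lL; rewrite E (Hgt_run hz ip ub hL).
Qed.

(** * Countably valued random variables *)

Section countable_valued.
Context (d : measure_display) (T : measurableType d).

Lemma measurable_forall_count (C : countType) (Q : C -> T -> Prop) :
  (forall c, measurable [set w | Q c w]) -> measurable [set w | forall c, Q c w].
Proof.
move=> h.
have -> : [set w | forall c, Q c w] =
    \bigcap_k (if choice.unpickle k is Some c then [set w | Q c w] else setT).
  apply/seteqP; split => w /= hw.
    by move=> k _; case: choice.unpickle => [c|//]; exact: hw.
  by move=> c; have := hw (choice.pickle c) I; rewrite choice.pickleK.
by apply: bigcapT_measurable => k; case: choice.unpickle.
Qed.

Lemma measurable_exists_count (C : countType) (Q : C -> T -> Prop) :
  (forall c, measurable [set w | Q c w]) -> measurable [set w | exists c, Q c w].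
Proof.
move=> h.
have -> : [set w | exists c, Q c w] = ~` [set w | forall c, ~ Q c w].
  by apply/seteqP; split => w /=; rewrite -existsNP => -[c] hc; exists c => //;
    apply: contrapT.
apply: measurableC; apply: measurable_forall_count => c.
exact: (measurableC (h c)).
Qed.

Lemma measurable_imply (A : Prop) (Q : T -> Prop) :
  (A -> measurable [set w | Q w]) -> measurable [set w | A -> Q w].
Proof.
move=> h; have [a|na] := pselect A.
  have -> : [set w | A -> Q w] = [set w | Q w]; last exact: h.
  by apply/seteqP; split => w //= /(_ a).
have -> // : [set w | A -> Q w] = setT.
by apply/seteqP; split => w //=.
Qed.

Lemma measurable_fibers (d' : measure_display) (C : measurableType d') (D : countType)
  (g : D -> C) (f : T -> D) :
  (forall c, measurable [set w | f w = c]) -> measurable_fun setT (g \o f).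
Proof.
move=> h _ A mA; rewrite setTI.
have -> : (g \o f) @^-1` A = [set w | exists c, A (g c) /\ f w = c].
  by apply/seteqP; split => w /=; [move=> Aw; exists (f w)|move=> [c [Ac ->]]].
apply: measurable_exists_count => c.
have [a|na] := pselect (A (g c)).
  have -> : [set w | A (g c) /\ f w = c] = [set w | f w = c] by
    apply/seteqP; split => w //= -[].
  exact: h.
have -> // : [set w | A (g c) /\ f w = c] = set0.
by apply/seteqP; split => w //= -[].
Qed.

(* Functions into countable types are handled through their fibers, so that a
   random index can be substituted in a family of such functions. *)
Definition fiber_measurable (C : Type) (f : T -> C) :=
  forall c, measurable [set w | f w = c].

Lemma fiber_cst (C : Type) (c : C) : fiber_measurable (fun _ : T => c).
Proof.
move=> c'; have [->|ne] := pselect (c = c').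
  by rewrite (_ : [set w | _] = setT)//; apply/seteqP; split.
by rewrite (_ : [set w | _] = set0)//; apply/seteqP; split => // w /=.
Qed.

Lemma fiber_bind (C : countType) (D : Type) (f : T -> C) (Z : C -> T -> D) :
  fiber_measurable f -> (forall c, fiber_measurable (Z c)) ->
  fiber_measurable (fun w => Z (f w) w).
Proof.
move=> hf hZ v.
rewrite (_ : [set w | _] = [set w | exists c, f w = c /\ Z c w = v]).
  apply: measurable_exists_count => c.
  exact: (measurableI _ _ (hf c) (hZ c v)).
by apply/seteqP; split => w /=; [move=> e; exists (f w)|move=> [c [<-]]].
Qed.

Lemma fiber_comp (C : countType) (D : Type) (f : T -> C) (g : C -> D) :
  fiber_measurable f -> fiber_measurable (fun w => g (f w)).
Proof.
by move=> hf; apply: (@fiber_bind _ _ f (fun c _ => g c)) => // c; exact: fiber_cst.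
Qed.

Lemma fiber_comp2 (C C' : countType) (D : Type) (f : T -> C) (f' : T -> C')
  (g : C -> C' -> D) : fiber_measurable f -> fiber_measurable f' ->
  fiber_measurable (fun w => g (f w) (f' w)).
Proof.
move=> hf hf'; apply: (@fiber_bind _ _ f (fun c w => g c (f' w))) => // c.
exact: fiber_comp.
Qed.

Lemma fiber_set (C : countType) (f : T -> C) (A : set C) :
  fiber_measurable f -> measurable [set w | A (f w)].
Proof.
move=> hf.
have -> : [set w | A (f w)] = [set w | `[< A (f w) >] = true].
  by apply/seteqP; split => w /= /asboolP.
exact: (fiber_comp (fun c => `[< A c >]) hf).
Qed.

Lemma fiber_ffun (I : finType) (C : countType) (f : I -> T -> C) :
  (forall i, fiber_measurable (f i)) ->
  fiber_measurable (fun w => [ffun i => f i w]).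
Proof.
move=> hf g.
rewrite (_ : [set w | _] = [set w | forall i, f i w = g i]).
  by apply: measurable_forall_count => i; exact: hf.
apply/seteqP; split => w /=; first by move=> <- i; rewrite ffunE.
by move=> h; apply/ffunP => i; rewrite ffunE.
Qed.

End countable_valued.

Lemma pickle_fiber (T : Type) (C : countType) (f : T -> C) k c :
  pickle_inv k = Some c ->
  [set w | choice.pickle (f w) = k] = [set w | f w = c].
Proof.
move=> ck; apply/seteqP; split => w /= h.
  by move: ck; rewrite -h pickleK_inv => -[].
by rewrite h; have := @pickle_invK C k; rewrite ck.
Qed.

Section laws.
Context (R : realType) (d : measure_display) (T : measurableType d)
  (P : probability T R).
Local Open Scope ereal_scope.

(** Values enter through their [pickle] codes, which turns the decomposition into a series over the
    naturals. *)
Lemma total_probability (C : countType) (f : T -> C) (E : set T) (A : set C) :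
  measurable E -> fiber_measurable f ->
  P (E `&` [set w | A (f w)]) =
  \sum_(k <oo | k \in [set k | exists2 c, pickle_inv k = Some c & A c])
    P (E `&` [set w | choice.pickle (f w) = k]).
Proof.
move=> mE hf; rewrite -measure_bigcup.
- congr (P _); rewrite -setI_bigcupr; congr (_ `&` _).
  apply/seteqP; split => w /=.
    by move=> Aw; exists (choice.pickle (f w)) => //=; exists (f w) => //; rewrite pickleK_inv.
  by move=> [k [c ck Ac] /= e]; move: ck; rewrite -e pickleK_inv => -[->].
- move=> k _; apply: measurableI => //.
  exact: (fiber_comp choice.pickle hf).
- by move=> i j _ _ [w [[_ /= <-] [_ /= <-]]].
Qed.

Lemma ae_foralln_count (C : countType) (Q : C -> T -> Prop) :
  (forall c, {ae P, forall w, Q c w}) -> {ae P, forall w, forall c, Q c w}.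
Proof.
move=> h.
have := @ae_foralln _ T R P
  (fun k w => if choice.unpickle k is Some c then Q c w else True).
move=> /(_ _)/filterS; apply.
  move=> w hw c; have := hw (choice.pickle c); by rewrite choice.pickleK.
by move=> k; case: choice.unpickle => [c|]; [exact: h|exact: aeW].
Qed.

Lemma aeP (A : set T) : measurable A -> {ae P, forall w, A w} <-> P A = 1.
Proof.
move=> mA; rewrite /almost_everywhere/= /prop_near1 /nbhs /=.
have mC := measurableC mA.
split.
  move=> h; have : P (~` A) = 0 := measure_negligible mC h.
  rewrite (probability_setC P mA) -(fineK (fin_num_measure P _ mA)).
  by rewrite -EFinB => -[/subr0_eq <-].
move=> PA; apply/(negligibleP _ mC).
by have := probability_setC P mA; rewrite PA subee.
Qed.

Lemma ae_eq_measure (A B : set T) : measurable A -> measurable B ->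
  {ae P, forall w, A w <-> B w} -> P A = P B.
Proof.
suff h A' B' : measurable A' -> measurable B' ->
    {ae P, forall w, A' w <-> B' w} -> P A' <= P B'.
  move=> mA mB AB; apply/eqP; rewrite eq_le !h//.
  by apply: filterS AB => w [].
move=> mA mB [N [mN N0 hN]].
have mBN := measurableU _ _ mB mN.
apply: (@le_trans _ _ (P (B' `|` N))).
  apply: le_measure; rewrite ?inE// => w Aw.
  have [Bw|nBw] := pselect (B' w); [by left|right].
  by apply: hN => /= -[/(_ Aw)].
have := measureU2 P mB mN; rewrite [X in (_ + X)%E](_ : _ = 0)//.
by rewrite adde0.
Qed.

End laws.

Lemma eq_law_countable (R : realType) (d d' : measure_display)
    (T : measurableType d) (T' : measurableType d')
    (P : probability T R) (P' : probability T' R) (C : countType)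
    (f : T -> C) (f' : T' -> C) : fiber_measurable f -> fiber_measurable f' ->
  (forall c, P [set w | f w = c] = P' [set w | f' w = c]) ->
  forall A : set C, P [set w | A (f w)] = P' [set w | A (f' w)].
Proof.
move=> hf hf' e A.
have := total_probability P A measurableT hf.
have := total_probability P' A measurableT hf'.
rewrite !setTI => -> ->; apply: eq_eseriesr => k.
by rewrite inE => -[c ck _]; rewrite !setTI !(pickle_fiber _ ck).
Qed.

(** * Independence *)

Section independence.
Context (R : realType) (d d' : measure_display) (T : measurableType d)
  (E : measurableType d') (P : probability T R) (I : choiceType)
  (xi : I -> {mfun T >-> E}).
Local Open Scope ereal_scope.

Lemma measurable_seq_preimage (K : eqType) (s : seq K) (iota : K -> I)
    (A : K -> set E) : (forall k, measurable (A k)) ->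
  measurable [set w | forall k, k \in s -> A k (xi (iota k) w)].
Proof.
move=> mA.
rewrite (_ : [set w | _] = \big[setI/setT]_(k <- s) (xi (iota k) @^-1` A k)).
  by apply: bigsetI_measurable => k _; exact: measurable_funPTI.
apply/seteqP; split => w /=.
  elim: s => [|k s ih] h; first by rewrite big_nil.
  rewrite big_cons; split; first by apply: h; exact: mem_head.
  by apply: ih => k' ks; apply: h; rewrite inE ks orbT.
elim: s => [|k s ih]; first by rewrite big_nil.
rewrite big_cons => -[h1 h2] k'; rewrite inE => /predU1P[->//|].
exact: ih.
Qed.

Hypothesis hxi : mutually_independent P xi.

Lemma mutually_independent_seq (K : eqType) (s : seq K) (iota : K -> I)
    (A : K -> set E) : (forall k, measurable (A k)) -> uniq s ->
  {in s &, injective iota} ->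
  P [set w | forall k, k \in s -> A k (xi (iota k) w)] =
  \prod_(k <- s) P [set w | A k (xi (iota k) w)].
Proof.
move=> mA us inj.
(* Independence wants one event for each element of [I]; away from the image of [s] the condition is
   void and gives the whole space. *)
pose A' i := [set e | forall k, k \in s -> iota k = i -> A k e].
have A'E k : k \in s -> A' (iota k) = A k.
  move=> ks; apply/seteqP; split => e /=; first by apply.
  by move=> h k' ks' e'; rewrite (inj _ _ ks' ks e').
have mA' i : measurable (A' i).
  have [[k ks <-]|no] := pselect (exists2 k, k \in s & iota k = i).
    by rewrite A'E.
  rewrite (_ : A' i = setT)//; apply/seteqP; split => // e _ k ks ki.
  by exfalso; apply: no; exists k.
pose J := [fset i in [seq iota k | k <- s]]%fset.
have := hxi J mA'.
rewrite (_ : \bigcap_(i in [set` J]) _ =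
  [set w | forall k, k \in s -> A k (xi (iota k) w)]); last first.
  apply/seteqP; split => w /= h.
    move=> k ks; rewrite -(A'E k ks).
    by apply: (h (iota k)); rewrite /= inE /=; exact: map_f.
  by move=> i /=; rewrite inE /= => /mapP[k ks ->]; rewrite /= A'E//; exact: h.
move=> ->; rewrite (perm_big [seq iota k | k <- s]) /=; last first.
  apply: uniq_perm; first exact: fset_uniq.
    by rewrite map_inj_in_uniq.
  by move=> i; rewrite inE.
rewrite big_map; apply: eq_big_seq => k ks.
by rewrite A'E.
Qed.

(* A weak form of the second Borel-Cantelli lemma. *)
Lemma independent_blocks_occur (m : nat) (iota : nat -> 'I_m -> I)
    (A : nat -> 'I_m -> set E) (c : R) :
  (forall n l n' l', iota n l = iota n' l' -> n = n' /\ l = l') ->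
  (forall n l, measurable (A n l)) -> (0 < c)%R ->
  (forall n l, c%:E <= P [set w | A n l (xi (iota n l) w)]) ->
  {ae P, forall w, exists n, forall l, A n l (xi (iota n l) w)}.
Proof.
move=> inj mA c0 hc.
pose ev (s : seq (nat * 'I_m)) :=
  [set w | forall k, k \in s -> A k.1 k.2 (xi (iota k.1 k.2) w)].
have mev s : measurable (ev s).
  exact: (@measurable_seq_preimage _ s (fun k => iota k.1 k.2) (fun k => A k.1 k.2)).
have inj' (s : seq (nat * 'I_m)) : {in s &, injective (fun k : nat * 'I_m => iota k.1 k.2)}.
  by move=> [n l] [n' l'] _ _ /inj[/= -> ->].
have Pev s : uniq s -> P (ev s) =
    \prod_(k <- s) P [set w | A k.1 k.2 (xi (iota k.1 k.2) w)].
  move=> us; exact: (@mutually_independent_seq _ s (fun k => iota k.1 k.2)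
    (fun k => A k.1 k.2) _ us (inj' s)).
pose blk (n : nat) := [seq (n, l) | l <- enum 'I_m].
have ublk n : uniq (blk n) by rewrite map_inj_uniq ?enum_uniq// => l l' [].
have in_blk n k : k \in blk n = (k.1 == n).
  case: k => n' l /=; apply/mapP/eqP => [[l' _ []//]|->].
  by exists l; rewrite ?mem_enum.
pose F (n : nat) := ev (blk n).
pose q n := fine (P (F n)).
have qE n : (q n)%:E = P (F n) := fineK (fin_num_measure P _ (mev _)).
pose G N := \big[setI/setT]_(n < N) ~` F n.
have mG N : measurable (G N).
  by apply: bigsetI_measurable => n _; apply: measurableC; exact: mev.
(* An event [ev s] on later blocks is carried along: the complement of block [N] is handled by
   subtracting the case in which that block is appended to [s]. *)
have PG N : forall s, uniq s -> (forall k, k \in s -> (N <= k.1)%N) ->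
    P (G N `&` ev s) = (\prod_(n < N) (1 - q n))%:E * P (ev s).
  elim: N => [|N ih] s us hs.
    by rewrite /G big_ord0 setTI big_ord0 mul1e.
  have us' : uniq (blk N ++ s).
    rewrite cat_uniq ublk us andbT /=; apply/hasPn => k ks.
    by rewrite /= in_blk neq_ltn (hs k ks) orbT.
  have Ecat : ev (blk N ++ s) = ev s `&` F N.
    apply/seteqP; split => w /=.
      by move=> h; split => k ks; apply: h; rewrite mem_cat ks ?orbT.
    by move=> [h1 h2] k; rewrite mem_cat => /orP[/h2|/h1].
  have Pcat : P (ev (blk N ++ s)) = P (F N) * P (ev s).
    by rewrite /F !Pev// big_cat.
  have := ih s us (fun k ks => ltnW (hs k ks)).
  have := ih (blk N ++ s) us'.
  have hs' k : k \in blk N ++ s -> (N <= k.1)%N.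
    by rewrite mem_cat in_blk => /orP[/eqP ->//|/hs /ltnW].
  move=> /(_ hs') h1 h2.
  have -> : G N.+1 `&` ev s = (G N `&` ev s) `\` F N.
    by rewrite /G big_ord_recr /= setDE -!setIA; congr (_ `&` _); rewrite setIC.
  have mF : measurable (F N) by exact: mev.
  have mGs : measurable (G N `&` ev s) by exact: measurableI.
  transitivity (P (G N `&` ev s) - P (G N `&` ev s `&` F N)).
    by apply: measureD => //; rewrite (le_lt_trans (probability_le1 P mGs)) ?ltry.
  rewrite h2 -setIA -Ecat h1 Pcat -qE big_ord_recr /=.
  rewrite -(fineK (fin_num_measure P _ (mev s))) -!EFinM -EFinB; congr EFin.
  ring.
have qge n : (c ^+ m <= q n)%R.
  rewrite -lee_fin qE /F Pev// big_map /= big_enum /=.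
  have := fun l => fineK (fin_num_measure P _
    (measurable_funPTI (xi (iota n l)) (mA n l))).
  move=> pE; under eq_bigr do rewrite -pE.
  rewrite prodEFin lee_fin -[leLHS]/((c ^+ m)%R).
  rewrite -[X in (c ^+ X <= _)%R]card_ord -prodr_const.
  apply: ler_prod => l _; rewrite ltW//= -lee_fin pE; exact: hc.
have qle n : (q n <= 1)%R by rewrite -lee_fin qE probability_le1//; exact: mev.
have PGle N : P (G N) <= ((1 - c ^+ m) ^+ N)%:E.
  have := PG N [::] isT; rewrite (_ : ev [::] = setT); last first.
    by apply/seteqP; split => w.
  rewrite setIT probability_setT mule1 => ->//.
  rewrite lee_fin -[X in (_ <= _ ^+ X)%R]card_ord -prodr_const.
  by apply: ler_prod => n _; rewrite subr_ge0 qle lerD2l lerN2 qge.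
have mB : measurable (\bigcap_n ~` F n).
  by apply: bigcapT_measurable => n; apply: measurableC; exact: mev.
exists (\bigcap_n ~` F n); split => //; last first.
  move=> w /= h n _ Fw; apply: h; exists n => l.
  by apply: (Fw (n, l)); rewrite in_blk.
have PBle N : P (\bigcap_n ~` F n) <= ((1 - c ^+ m) ^+ N)%:E.
  apply: le_trans (PGle N); apply: le_measure; rewrite ?inE//.
  by rewrite /G; elim/big_ind : _ => // [A1 A2 h1 h2 w hw|n _ w]; [split; auto|exact].
apply/eqP; rewrite eq_le measure_ge0 andbT.
have PBE := fineK (fin_num_measure P _ mB).
rewrite -PBE lee_fin.
have c1 : (`|1 - c ^+ m| < 1)%R.
  have cm : (0 < c ^+ m)%R by rewrite exprn_gt0.
  have cm1 := le_trans (qge 0%N) (qle 0%N).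
  by rewrite ger0_norm ?subr_ge0// ltrBlDr ltrDl.
apply: (cvgr_to_ge (cvg_expr c1)).
by apply: nearW => N; rewrite -lee_fin PBE.
Qed.

End independence.

Lemma mfun_fiber (d : measure_display) (T : measurableType d)
  (d' : measure_display) (E : measurableType d') (xi : {mfun T >-> E}) :
  (forall e : E, measurable [set e]) -> fiber_measurable xi.
Proof. by move=> h e; exact: (measurable_funPTI xi (h e)). Qed.

Section independence_singletons.
Context (R : realType) (d : measure_display) (T : measurableType d)
  (P : probability T R) (I : choiceType) (xi : I -> {mfun T >-> nat}).
Local Open Scope ereal_scope.

Lemma mutually_independent_singletons :
  (forall (s : seq I) (r : I -> nat), uniq s ->
    P [set w | forall i, i \in s -> xi i w = r i] =
    \prod_(i <- s) P [set w | xi i w = r i]) ->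
  mutually_independent P xi.
Proof.
move=> h J A mA.
have fxi i : fiber_measurable (xi i) by exact: mfun_fiber.
(* Indices of [s2] are tied to single values, those of [s1] to general events. Summing over the
   values of the head of [s1] moves it to [s2]. *)
have main (s1 s2 : seq I) (r : I -> nat) : uniq (s1 ++ s2) ->
    P ([set w | forall i, i \in s2 -> xi i w = r i] `&`
       [set w | forall i, i \in s1 -> A i (xi i w)]) =
    \prod_(i <- s2) P [set w | xi i w = r i] *
    \prod_(i <- s1) P (xi i @^-1` A i).
  elim: s1 s2 r => [|i s1 ih] s2 r us.
    rewrite big_nil mule1 -h//; congr (P _).
    by apply/seteqP; split => w //= -[].
  pose E := [set w | forall i, i \in s2 -> xi i w = r i] `&`
    [set w | forall i, i \in s1 -> A i (xi i w)].
  have mE : measurable E.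
    apply: measurableI.
      exact: (@measurable_seq_preimage _ _ _ _ _ xi I s2 id (fun i => [set r i])).
    exact: (@measurable_seq_preimage _ _ _ _ _ xi I s1 id A).
  rewrite (_ : _ `&` _ = E `&` [set w | A i (xi i w)]); last first.
    apply/seteqP; split => w /=.
      move=> [h1 h2]; split; last by apply: h2; exact: mem_head.
      by split=> // j js; apply: h2; rewrite inE js orbT.
    by move=> [[h1 h2] h3]; split=> // j; rewrite inE => /predU1P[->//|]; exact: h2.
  rewrite (total_probability P (A i) mE (fxi i)).
  rewrite big_cons (muleC (P _) (\prod_(_ <- s1) _)) muleA.
  have := total_probability P (A i) measurableT (fxi i); rewrite setTI.
  rewrite /preimage => ->.
  have P2E : \prod_(i <- s2) P [set w | xi i w = r i] *
    \prod_(i <- s1) P (xi i @^-1` A i) \is a fin_num.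
    rewrite fin_numM// prode_fin_num// => j _; rewrite fin_num_measure//.
      exact: fxi.
    exact: measurable_funPTI.
  rewrite -[X in X * _](fineK P2E) -nneseriesZl; last by move=> k _; exact: measure_ge0.
  rewrite fineK//; apply: eq_eseriesr => k; rewrite inE => -[c ck Ac].
  rewrite setTI.
  rewrite (pickle_fiber _ ck).
  move: us; rewrite cat_cons cons_uniq mem_cat negb_or => /andP[/andP[is1 is2] us].
  have us' : uniq (s1 ++ i :: s2).
    by rewrite uniq_catC cat_cons cons_uniq mem_cat negb_or is2 is1 uniq_catC.
  have := ih (i :: s2) (fun j => if j == i then c else r j) us'.
  rewrite big_cons eqxx.
  rewrite (_ : _ `&` _ = E `&` [set w | xi i w = c]); last first.
    apply/seteqP; split => w /=.
      move=> [h1 h2]; split; last by have := h1 i (mem_head _ _); rewrite eqxx.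
      split=> // j js; have := h1 j; rewrite inE js orbT => /(_ isT) ->.
      by case: eqP => // ji; rewrite -ji js in is2.
    move=> [[h1 h2] h3]; split=> // j; rewrite inE => /predU1P[->|js].
      by rewrite eqxx.
    by rewrite h1//; case: eqP => // ji; rewrite -ji js in is2.
  move=> ->; rewrite -muleA muleC; congr (_ * _ * _).
  apply: eq_big_seq => j js; congr (P _); apply/seteqP; split => w /=.
    by case: eqP => // ji; rewrite -ji js in is2.
  by case: eqP => // ji; rewrite -ji js in is2.
have := main J [::] (fun=> 0%N); rewrite cats0 big_nil mul1e => <-; last exact: fset_uniq.
congr (P _); apply/seteqP; split => w /= hw; first by split => // i iJ; exact: hw.
by move=> i /= iJ; case: hw => _; apply.
Qed.

End independence_singletons.

Lemma mutually_independent_map (R : realType) (d d1 d2 : measure_display)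
    (T : measurableType d) (E1 : measurableType d1) (E2 : measurableType d2)
    (P : probability T R) (I1 I2 : choiceType) (xi : I1 -> {mfun T >-> E1})
    (iota : I2 -> I1) (g : I2 -> E1 -> E2) (xi' : I2 -> {mfun T >-> E2}) :
  mutually_independent P xi -> injective iota ->
  (forall i, measurable_fun setT (g i)) ->
  (forall i w, xi' i w = g i (xi (iota i) w)) ->
  mutually_independent P xi'.
Proof.
move=> h inj mg xiE J A mA.
have xiE' i : xi' i @^-1` A i = [set w | (g i @^-1` A i) (xi (iota i) w)].
  by apply/seteqP; split => w /=; rewrite xiE.
have mA' i : measurable (g i @^-1` A i) by have := mg i measurableT _ (mA i); rewrite setTI.
under eq_bigr do rewrite xiE'.
rewrite -(mutually_independent_seq h mA' (fset_uniq J)); last by move=> i j _ _; exact: inj.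
congr (P _); apply/seteqP; split => w /= hw i iJ.
  by have := hw i iJ; rewrite /= xiE.
by rewrite /= xiE; exact: hw.
Qed.

(** * Laws of array-valued processes on path space *)

Definition path_cyl (S : Type) (D : set S) : set (set (S -> array)) :=
  [set C | exists (q : nat) (t : 'I_q -> S) (n k v : 'I_q -> nat),
    [/\ forall l, D (t l), forall l, (k l <= n l)%N &
      C = [set f | forall l, f (t l) (n l) (k l) = v l]]].

Lemma path_cylI (S : Type) (D : set S) : setI_closed (path_cyl D).
Proof.
move=> _ _ [q1 [t1 [n1 [k1 [v1 [D1 h1 ->]]]]]] [q2 [t2 [n2 [k2 [v2 [D2 h2 ->]]]]]].
pose cmb U (f1 : 'I_q1 -> U) (f2 : 'I_q2 -> U) (l : 'I_(q1 + q2)) :=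
  match fintype.split l with inl l1 => f1 l1 | inr l2 => f2 l2 end.
exists (q1 + q2)%N, (cmb _ t1 t2), (cmb _ n1 n2), (cmb _ k1 k2), (cmb _ v1 v2).
split; try by move=> l; rewrite /cmb; case: fintype.split.
apply/seteqP; split => f /=.
  by move=> [e1 e2] l; rewrite /cmb; case: fintype.split.
move=> e; split => l.
  by have := e (lshift _ l); rewrite /cmb (unsplitK (inl l : 'I_q1 + 'I_q2)).
by have := e (rshift _ l); rewrite /cmb (unsplitK (inr l : 'I_q1 + 'I_q2)).
Qed.

Definition path_space (S : Type) (D : set S) :
  measurableType (sigma_display (path_cyl D)) := g_sigma_algebraType (path_cyl D).

Section path_laws.
Context (R : realType) (S : Type) (D : set S).

Let Omega := path_space D.

Lemma measurable_path_map (d : measure_display) (T : measurableType d)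
    (X : S -> T -> array) : measurable_process D X ->
  @measurable_fun _ _ T (path_space D) setT (fun w => X ^~ w).
Proof.
move=> mX; refine (@measurability _ _ T Omega setT (fun w => X ^~ w) (path_cyl D) _ _) => //.
move=> _ [_ [q [t [n [k [v [Dt kn ->]]]]]] <-]; rewrite setTI.
apply: measurable_forall_count => l.
have := mX (t l) (n l) (k l) (Dt l) (kn l) measurableT [set v l].
by rewrite setTI; exact.
Qed.

Lemma fiber_path (t : S) n k : D t -> (k <= n)%N ->
  fiber_measurable (fun f : path_space D => f t n k).
Proof.
move=> Dt kn v; apply: sub_sigma_algebra.
exists 1%N, (fun=> t), (fun=> n), (fun=> k), (fun=> v); split=> //.
by apply/seteqP; split => f /= h; [move=> _|apply: (h ord0)].
Qed.

(** The extension beyond cylinders is needed because [Hgt] reads infinitely many levels: a cylinder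
    of the height process is not one of the original process. *)
Lemma eq_law_path (d d' : measure_display) (T : measurableType d)
    (T' : measurableType d') (P : probability T R) (X : S -> T -> array)
    (P' : probability T' R) (X' : S -> T' -> array) : eq_law D P X P' X' ->
  forall C : set (path_space D), measurable C ->
    P [set w | C (X ^~ w)] = P' [set w | C (X' ^~ w)].
Proof.
move=> [mX mX' e] C mC.
pose Y : {mfun T >-> Omega} := mfun_Sub (mem_set (measurable_path_map mX)).
pose Y' : {mfun T' >-> Omega} := mfun_Sub (mem_set (measurable_path_map mX')).
apply: (@measure_unique _ R Omega (path_cyl D) (fun=> setT) _ _ _ _
  (distribution P Y) (distribution P' Y')) => //.
- exact: path_cylI.
- move=> _; have t : 'I_0 -> S by case.
  exists 0%N, t, (fun=> 0%N), (fun=> 0%N), (fun=> 0%N); split=> //; try by case.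
  by apply/seteqP; split => // f _ [].
- by rewrite bigcup_const.
- move=> _ [q [t [n [k [v [Dt kn ->]]]]]]; exact: e.
- by move=> _; rewrite -[X in (X < _)%E]/(P setT) probability_setT ltry.
Qed.


Lemma eq_law_sym (d d' : measure_display) (T : measurableType d)
    (T' : measurableType d') (P : probability T R) (X : S -> T -> array)
    (P' : probability T' R) (X' : S -> T' -> array) :
  eq_law D P X P' X' -> eq_law D P' X' P X.
Proof. by move=> [h1 h2 h3]; split=> // *; rewrite h3. Qed.

Lemma eq_law_trans (d1 d2 d3 : measure_display) (T1 : measurableType d1)
    (T2 : measurableType d2) (T3 : measurableType d3)
    (P1 : probability T1 R) (X1 : S -> T1 -> array)
    (P2 : probability T2 R) (X2 : S -> T2 -> array)
    (P3 : probability T3 R) (X3 : S -> T3 -> array) :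
  eq_law D P1 X1 P2 X2 -> eq_law D P2 X2 P3 X3 -> eq_law D P1 X1 P3 X3.
Proof. by move=> [h1 _ h3] [_ h4 h5]; split=> // *; rewrite h3// h5. Qed.

Lemma fiber_process (d : measure_display) (T : measurableType d)
    (X : S -> T -> array) : measurable_process D X ->
  forall t n k, D t -> (k <= n)%N -> fiber_measurable (fun w => X t w n k).
Proof.
move=> mX t n k Dt kn v.
by have := mX t n k Dt kn measurableT [set v]; rewrite setTI; exact.
Qed.

Lemma process_fiber (d : measure_display) (T : measurableType d)
    (X : S -> T -> array) :
  (forall t n k, D t -> (k <= n)%N -> fiber_measurable (fun w => X t w n k)) ->
  measurable_process D X.
Proof.
move=> h t n k Dt kn.
exact: (@measurable_fibers _ T _ nat nat id (fun w => X t w n k) (h t n k Dt kn)).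
Qed.

Lemma eq_law_ae (d : measure_display) (T : measurableType d)
    (P : probability T R) (X X' : S -> T -> array) :
  measurable_process D X -> measurable_process D X' ->
  (forall t, D t -> {ae P, forall w, eq_array (X t w) (X' t w)}) ->
  eq_law D P X P X'.
Proof.
move=> mX mX' h; split=> // q t n k v Dt kn; apply: ae_eq_measure.
- by apply: measurable_forall_count => l; exact: (fiber_process mX).
- by apply: measurable_forall_count => l; exact: (fiber_process mX').
have := @ae_foralln_count _ _ _ P 'I_q
  (fun l w => eq_array (X (t l) w) (X' (t l) w)) (fun l => h _ (Dt l)).
apply: filterS => w hw /=.
by split=> e l; move: (e l); rewrite hw.
Qed.

End path_laws.

Lemma measurable_prop (d : measure_display) (T : measurableType d) (A : Prop) :
  measurable [set _ : T | A].
Proof.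
have [a|na] := pselect A.
  by rewrite (_ : [set _ | A] = setT)//; apply/seteqP; split.
by rewrite (_ : [set _ | A] = set0)//; apply/seteqP; split.
Qed.

(** Measurability concerns all outcomes, also those outside [IA*]. Either nothing is counted from
    some level [N] on, and the count is a finite sum, or the set is infinite and its default
    cardinality zero gives the value [i]. *)
Lemma fiber_Hgt (d : measure_display) (T : measurableType d) (x : T -> array) j i :
  (forall n, (i <= n)%N -> fiber_measurable (fun w => x w n i)) ->
  fiber_measurable (fun w => Hgt (x w) j i).
Proof.
move=> hx v.
pose S w := [set n | (i <= n)%N /\ (j < x w n i)%N].
pose Q N w := forall n, (i <= n)%N -> (N <= n)%N -> ~~ (j < x w n i)%N.
pose cnt N w := count (fun n => (j < x w n i)%N) (iota i (N - i)).
have HQ N w : Q N w -> Hgt (x w) j i = (cnt N w + i)%N.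
  move=> hQ; rewrite /Hgt /hgt_fun; congr (_ + _)%N.
  rewrite (_ : [set n | _] = [set` [fset n in [seq n <- iota i (N - i) | (j < x w n i)%N]]%fset]).
    rewrite set_fsetK card_fseq undup_id ?filter_uniq ?iota_uniq//.
    by rewrite size_filter.
  apply/seteqP; split => n /=; rewrite !inE/= mem_filter mem_iota.
    move=> [i_n jx]; rewrite jx i_n /=.
    have [Nn|nN] := leqP N n; first by have := hQ n i_n Nn; rewrite jx.
    by rewrite subnKC//; lia.
  by move=> /andP[-> /andP[-> _]].
have HnQ w : ~ (exists N, Q N w) -> Hgt (x w) j i = i.
  move=> nQ; rewrite /Hgt /hgt_fun /fset_set.
  case: pselect => [fin|_]; last by rewrite cardfs0.
  exfalso; apply: nQ; move: fin => /finite_seqP[s sE].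
  have [N hN] : exists N, forall n, n \in s -> (n < N)%N.
    elim: s {sE} => [|a s [N hN]]; first by exists 0%N.
    exists (maxn a.+1 N) => n; rewrite inE => /predU1P[->|/hN nN].
      by rewrite leq_max leqnn.
    by rewrite leq_max nN orbT.
  exists N => n i_n Nn; apply/negP => jn; have : [set` s] n by rewrite -sE.
  by move=> /= /hN; rewrite ltnNge Nn.
have mQ N : measurable [set w | Q N w].
  apply: measurable_forall_count => n; apply: measurable_imply => i_n.
  apply: measurable_imply => _.
  exact: (fiber_set (fun a => ~~ (j < a)%N) (hx n i_n)).
have mcnt N : fiber_measurable (cnt N).
  have : forall n, n \in iota i (N - i) -> (i <= n)%N.
    by move=> n; rewrite mem_iota => /andP[].
  rewrite /cnt; elim: iota => [|n s ih] hs; first exact: fiber_cst.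
  apply: (@fiber_comp2 _ _ _ _ _ (fun w => x w n i)
    (fun w => count (fun n => (j < x w n i)%N) s) (fun a b => (j < a) + b)%N).
    by apply: hx; apply: hs; exact: mem_head.
  by apply: ih => m ms; apply: hs; rewrite inE ms orbT.
rewrite (_ : [set w | _] =
  [set w | exists N, Q N w /\ cnt N w = (v - i)%N /\ (i <= v)%N] `|`
  ([set w | ~ (exists N, Q N w)] `&` [set w | v = i])).
  apply: measurableU.
    apply: measurable_exists_count => N; apply: measurableI; first exact: mQ.
    apply: measurableI; first exact: mcnt.
    exact: measurable_prop.
  apply: measurableI; last exact: measurable_prop.
  by apply: measurableC; apply: measurable_exists_count.
apply/seteqP; split => w /=.
  move=> e; have [[N hN]|nN] := pselect (exists N, Q N w).
    left; exists N; split=> //; move: e; rewrite (HQ N)// => <-.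
    by rewrite addnK leq_addl.
  by right; split=> //; rewrite -e HnQ.
move=> [[N [hN [c iv]]]|[nN ->]]; last exact: HnQ.
by rewrite (HQ N)// c subnK.
Qed.

Lemma eq_law_Hgt (R : realType) (S : Type) (D : set S) (d d' : measure_display)
    (T : measurableType d) (T' : measurableType d') (P : probability T R)
    (X : S -> T -> array) (P' : probability T' R) (X' : S -> T' -> array) :
  eq_law D P X P' X' ->
  eq_law D P (fun t w => Hgt (X t w)) P' (fun t w => Hgt (X' t w)).
Proof.
move=> h; have [mX mX' _] := h; split.
- apply: process_fiber => t n k Dt kn; apply: fiber_Hgt => m km.
  exact: (fiber_process mX).
- apply: process_fiber => t n k Dt kn; apply: fiber_Hgt => m km.
  exact: (fiber_process mX').
move=> q t n k v Dt kn.
apply: (eq_law_path h (C := [set f | forall l, Hgt (f (t l)) (n l) (k l) = v l])).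
apply: measurable_forall_count => l; apply: fiber_Hgt => m km.
exact: fiber_path.
Qed.

(** * Discrete-time dynamics *)

(** [push] reads only the level just below, so that level can be passed as an array constant in the
    level. The dummy below level 0 is read by no meaningful entry. *)
Fixpoint ww_step (y : array) (g : nat -> nat -> nat -> nat) (n : nat) : nat -> nat :=
  let prev := if n is n'.+1 then ww_step y g n' else fun=> 0%N in
  fun i => let m := push (fun=> prev) n i (y n i) in block y n i (m + g i n m)%N.

Lemma ww_stepE y g n i : (i <= n)%N ->
  let m := push (ww_step y g) n i (y n i) in
  ww_step y g n i = block y n i (m + g i n m)%N.
Proof. by case: n => [|n] //; rewrite leqn0 => /eqP ->. Qed.

Fixpoint ww_path (G : nat * nat * nat * nat -> nat) (x : array) (t : nat) : array :=
  if t is t'.+1 then ww_step (ww_path G x t') (fun i n p => G (t', i, n, p)) else x.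

(* The position from which the particle [i] of level [n] jumps at time [t]. *)
Definition ww_mark (G : nat * nat * nat * nat -> nat) (x : array) (t n i : nat) : nat :=
  push (ww_path G x t.+1) n i (ww_path G x t n i).

Lemma ww_pathS G x t n i : (i <= n)%N -> ww_path G x t.+1 n i =
  block (ww_path G x t) n i (ww_mark G x t n i + G (t, i, n, ww_mark G x t n i))%N.
Proof. exact: ww_stepE. Qed.

Lemma ww_pathP G x (Y : nat -> array) : eq_array (Y 0%N) x ->
  (forall t n i, (i <= n)%N ->
    let m := push (Y t.+1) n i (Y t n i) in
    Y t.+1 n i = block (Y t) n i (m + G (t, i, n, m))%N) ->
  forall t, eq_array (Y t) (ww_path G x t).
Proof.
move=> Y0 hY; elim=> [//|t ih] n.
elim: n => [|n ihn] k kn; rewrite hY//.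
  by move: kn; rewrite leqn0 => /eqP ->; rewrite /= /block /push /= ih.
have pE : push (Y t.+1) n.+1 k (Y t n.+1 k) =
    push (ww_path G x t.+1) n.+1 k (ww_path G x t n.+1 k).
  by rewrite /push ih//; case: posnP => //= k0; rewrite ihn//; lia.
rewrite pE -/(ww_mark G x t n.+1 k) ww_pathS// /block; case: ifP => // kn'.
by rewrite ih.
Qed.

(** Each new entry reads its driver only at its mark. Agreement along the marks of one path
    suffices, since the marks of the other are then the same by induction. *)
Lemma ww_path_local G G' (x x' : array) (tm N : nat) : eq_array x x' ->
  (forall t n i, (t < tm)%N -> (n < N)%N -> (i <= n)%N ->
    G (t, i, n, ww_mark G x t n i) = G' (t, i, n, ww_mark G x t n i)) ->
  forall t n i, (t <= tm)%N -> (n < N)%N -> (i <= n)%N ->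
    ww_path G x t n i = ww_path G' x' t n i.
Proof.
move=> xx' h; elim=> [|t iht] n i; first by move=> _ _; exact: xx'.
move=> tt; have {}iht := fun n i => iht n i (ltnW tt).
elim: n i => [|n ihn] i nN i_n.
  have i0 : i = 0%N by lia.
  have := h t 0%N 0%N tt nN isT; rewrite i0 /= /ww_mark /block /push /=.
  by rewrite -iht// => ->.
have mE : ww_mark G x t n.+1 i = ww_mark G' x' t n.+1 i.
  rewrite /ww_mark /push iht//; case: posnP => //= i0.
  by have /= -> := ihn i.-1; lia.
have := h t n.+1 i tt nN i_n.
rewrite !ww_pathS// mE => ->.
by rewrite /block; case: ifP => // i_n'; rewrite iht//; lia.
Qed.

Section ww_law.
Context (R : realType).

Definition ww_weight (theta : nat -> nat -> R) (n p m : nat) : R :=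
  (\prod_(0 <= l < m) theta (p + l)%N n) * (1 - theta (p + m)%N n).

(* All that the law of the dynamics sees of the variables [G (t, i, n, p)]:
   only one position [p] is ever used for each [(t, i, n)]. *)
Definition ww_driven theta (d : measure_display) (T : measurableType d)
    (P : probability T R) (G : nat * nat * nat * nat -> T -> nat) : Prop :=
  (forall a, fiber_measurable (G a)) /\
  forall (s : seq (nat * nat * nat)) (p r : nat * nat * nat -> nat), uniq s ->
    P [set w | forall j, j \in s -> G (j, p j) w = r j] =
    (\prod_(j <- s) ww_weight theta j.2 (p j) (r j))%:E.

Lemma ww_driven_fiber theta (d : measure_display) (T : measurableType d)
    (P : probability T R) (G : nat * nat * nat * nat -> T -> nat) x :
  ww_driven theta P G ->
  (forall t n i, fiber_measurable (fun w => ww_path (G^~ w) x t n i)).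
Proof.
move=> [mG _]; elim=> [|t iht]; first by move=> n i; exact: fiber_cst.
have step n i (pr : nat -> T -> nat) : (forall j, fiber_measurable (pr j)) ->
    fiber_measurable (fun w => let m := push (fun=> pr^~ w) n i (ww_path (G^~ w) x t n i) in
      block (ww_path (G^~ w) x t) n i (m + G (t, i, n, m) w)%N).
  move=> hpr.
  have hm : fiber_measurable
      (fun w => push (fun=> pr^~ w) n i (ww_path (G^~ w) x t n i)).
    rewrite /push; case: (0 < i)%N; last exact: iht.
    exact: (fiber_comp2 (fun a b => maxn a b.+1) (iht n i) (hpr i.-1)).
  have hmg : fiber_measurable (fun w => let m :=
      push (fun=> pr^~ w) n i (ww_path (G^~ w) x t n i) in (m + G (t, i, n, m) w)%N).
    apply: (fiber_bind (Z := fun m w => (m + G (t, i, n, m) w)%N) hm) => m.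
    exact: (fiber_comp (addn m) (mG _)).
  rewrite /block; case: (i < n)%N => //.
  exact: (fiber_comp2 minn (iht _ _) hmg).
elim=> [|n ihn] i; last exact: (step n.+1 i (fun j w => ww_path (G^~ w) x t.+1 n j)).
by apply: (step 0%N i (fun _ _ => 0%N)) => j; exact: fiber_cst.
Qed.

(** A cylinder sees a finite window of indices, and the driver values actually used there determine
    the path. The law of this finite table of values is computed from [ww_driven] alone. *)
Lemma ww_driven_law theta (d d' : measure_display) (T : measurableType d)
    (T' : measurableType d') (P : probability T R) (P' : probability T' R)
    (G : nat * nat * nat * nat -> T -> nat)
    (G' : nat * nat * nat * nat -> T' -> nat) (x x' : array) :
  eq_array x x' -> ww_driven theta P G -> ww_driven theta P' G' ->
  eq_law [set: nat] P (fun t w => ww_path (G^~ w) x t)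
                    P' (fun t w => ww_path (G'^~ w) x' t).
Proof.
move=> xx' hG hG'; split.
- by apply: process_fiber => t n k _ _; exact: ww_driven_fiber hG _ _ _.
- by apply: process_fiber => t n k _ _; exact: ww_driven_fiber hG' _ _ _.
move=> q t n k v _ kn.
pose tm := (\max_(l < q) t l)%N; pose N := (\max_(l < q) n l).+1.
pose K : finType := ('I_tm * 'I_N * 'I_N)%type.
pose lvl (a : K) := (val a.1.2 <= val a.2)%N.
pose idx (a : K) : nat * nat * nat := (val a.1.1, val a.1.2, val a.2).
(* A table of used values becomes a driver that ignores the position, which loses nothing because
   each [(t, i, n)] is read at one position. *)
pose ext (g : {ffun K -> nat}) (a : nat * nat * nat * nat) : nat :=
  if [pick b : K | idx b == a.1] is Some b then g b else 0%N.
have idx_inj : injective idx.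
  by move=> [[a1 a2] a3] [[b1 b2] b3] [/val_inj -> /val_inj -> /val_inj ->].
have extE g a p : ext g (idx a, p) = g a.
  rewrite /ext /=; case: pickP => [b /eqP/idx_inj -> //|/(_ a)].
  by rewrite eqxx.
pose mark H y (a : K) := ww_mark H y (val a.1.1) (val a.2) (val a.1.2).
pose U d0 (T0 : measurableType d0) (H : nat * nat * nat * nat -> T0 -> nat)
    (y : array) (w : T0) : {ffun K -> nat} :=
  [ffun a : K => if lvl a then H (idx a, mark (H^~ w) y a) w else 0%N].
have loc F F' y y' : eq_array y y' ->
    (forall a, lvl a -> F (idx a, mark F y a) = F' (idx a, mark F y a)) ->
    forall t n i, (t <= tm)%N -> (n < N)%N -> (i <= n)%N ->
    ww_path F y t n i = ww_path F' y' t n i.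
  move=> yy' h; apply: ww_path_local => // t' n' i' tt nn ii.
  exact: (h (Ordinal tt, Ordinal (leq_ltn_trans ii nn), Ordinal nn)).
have locm F F' y y' : eq_array y y' ->
    (forall a, lvl a -> F (idx a, mark F y a) = F' (idx a, mark F y a)) ->
    forall a, lvl a -> mark F y a = mark F' y' a.
  move=> yy' h [[a i] m] /=; rewrite /lvl /= => im.
  have L := loc _ _ _ _ yy' h.
  have L0 := L a m i (ltnW (ltn_ord a)) (ltn_ord m) im.
  rewrite /mark /ww_mark /push /= L0; case: posnP => // i0.
  have im1 : (i.-1 <= m.-1)%N by rewrite -!subn1 leq_sub2r.
  have L1 := L a.+1 m.-1 i.-1 (ltn_ord a) (leq_ltn_trans (leq_pred m) (ltn_ord m)) im1.
  by rewrite /= in L1; rewrite L1.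
pose A : set {ffun K -> nat} :=
  [set g | forall l, ww_path (ext g) x (t l) (n l) (k l) = v l].
have pathE d0 (T0 : measurableType d0) (H : nat * nat * nat * nat -> T0 -> nat) z :
    eq_array x z ->
    [set w | forall l, ww_path (H^~ w) z (t l) (n l) (k l) = v l] =
    [set w | A (U _ _ H z w)].
  move=> xz; have zx : eq_array z x by move=> n0 k0 nk0; rewrite xz.
  have E w l : ww_path (ext (U _ _ H z w)) x (t l) (n l) (k l) =
      ww_path (H^~ w) z (t l) (n l) (k l).
    apply/esym; apply: loc => //.
    - by move=> b0 lb0; rewrite extE ffunE lb0.
    - exact: leq_bigmax.
    - by rewrite ltnS; exact: leq_bigmax.
  by apply/seteqP; split => w /= h l; [rewrite E|rewrite -E].
have mU d0 (T0 : measurableType d0) (P0 : probability T0 R)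
    (H : nat * nat * nat * nat -> T0 -> nat) y : ww_driven theta P0 H ->
    fiber_measurable (U _ _ H y).
  move=> hH; apply: fiber_ffun => a; case: (lvl a); last exact: fiber_cst.
  apply: (fiber_bind (Z := fun m w => H (idx a, m) w)); last first.
    by move=> m; case: hH.
  rewrite /mark /ww_mark /push; case: (0 < _)%N; last exact: ww_driven_fiber hH _ _ _.
  exact: (fiber_comp2 (fun a b => maxn a b.+1) (ww_driven_fiber _ hH _ _ _)
    (ww_driven_fiber _ hH _ _ _)).
(* Once the table is prescribed to be [g], the marks are those of [ext g], hence deterministic, and
   [ww_driven] applies. Entries with subscript above the level are fixed at 0. *)
have Ulaw d0 (T0 : measurableType d0) (P0 : probability T0 R)
    (H : nat * nat * nat * nat -> T0 -> nat) y : eq_array x y ->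
    ww_driven theta P0 H -> forall g, P0 [set w | U _ _ H y w = g] =
      if [forall a, ~~ lvl a ==> (g a == 0%N)] then
        (\prod_(j <- [seq idx a | a <- enum K & lvl a])
          ww_weight theta j.2 (ww_mark (ext g) x j.1.1 j.2 j.1.2) (ext g (j, 0%N)))%:E
      else 0%E.
  move=> xy hH g; case: ifPn => [/forallP g0|].
    have us : uniq [seq idx a | a <- enum K & lvl a].
      by rewrite map_inj_uniq// filter_uniq// enum_uniq.
    rewrite -(proj2 hH _ (fun j => ww_mark (ext g) x j.1.1 j.2 j.1.2)
      (fun j => ext g (j, 0%N)) us).
    congr (P0 _); apply/seteqP; split => w /= h.
      move=> j /mapP[a]; rewrite mem_filter mem_enum andbT => la ->.
      rewrite extE -/(mark (ext g) x a).
      rewrite -(locm (H^~ w) (ext g) y x)//; [|by move=> n0 k0 nk0; rewrite xy|].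
        by rewrite -h ffunE la.
      by move=> b lb; rewrite extE -h ffunE lb.
    apply/ffunP => a; rewrite ffunE; case: ifPn => la; last first.
      by have := g0 a; rewrite la => /eqP.
    have hb b : lvl b -> H (idx b, mark (ext g) x b) w = g b.
      move=> lb; have := h (idx b); rewrite extE; apply.
      by apply: map_f; rewrite mem_filter lb mem_enum.
    rewrite -(locm (ext g) (H^~ w) x y)//; first exact: hb.
    by move=> b lb; rewrite extE hb.
  rewrite negb_forall => /existsP[a]; rewrite negb_imply => /andP[la ga].
  rewrite (_ : [set w | _] = set0) ?measure0//.
  apply/seteqP; split => w //= e; move: ga; rewrite -e ffunE (negbTE la).
  by rewrite eqxx.
have x'x : eq_array x x by [].
rewrite (pathE _ _ G x)// (pathE _ _ G' x')//.
apply: eq_law_countable; [exact: mU hG|exact: mU hG'|] => g.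
by rewrite (Ulaw _ _ _ _ _ _ hG)// (Ulaw _ _ _ _ _ _ hG').
Qed.

End ww_law.

(** On a far diagonal the particle [l] sits at [l] and can be pushed only by its predecessor on the
    diagonal. If all their Bernoulli variables vanish, the diagonal does not move and coordinate [i]
    still attains [i]. *)
Lemma seq_step_IAstar (y y' : array) (b : nat -> nat -> nat -> bool) : IAstar y ->
  (forall n i, (i <= n)%N ->
    y' n i = block y' n i (push y' n i (y n i + b i n (y n i))%N)) ->
  (forall i N, exists2 n, (N <= n)%N & forall l, (l <= i)%N -> ~~ b l (n + l)%N l) ->
  IAstar y'.
Proof.
move=> hy hy' hb; have IA' := seq_step_IA hy'; apply: IAstarP => // i.
have [N hN] := IAstar_stable_upto i hy.
have [n Nn hn] := hb i N.
exists (n + i)%N; first exact: leq_addl.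
suff h l : (l <= i)%N -> y' (n + l)%N l = l by exact: h.
elim: l => [|l ih] li; apply/eqP; rewrite eqn_leq IA_ge ?leq_addl// andbT.
  rewrite hy' ?leq_addl// hN ?(leq_trans Nn)// ?leq_addr// (negbTE (hn _ li)).
  by rewrite /block /push /=; case: ifP; rewrite ?geq_minr.
rewrite hy' ?leq_addl// hN ?(leq_trans Nn)// ?leq_addr// (negbTE (hn _ li)) addn0.
rewrite /block /push /= addnS /= ih; last exact: ltnW.
by rewrite maxnn; case: ifP; rewrite ?geq_minr.
Qed.

(** * Runs of Bernoulli variables *)

Definition run (b : nat -> bool) : nat :=
  if pselect (exists m, ~~ b m) is left h then ex_minn h else 0%N.

Lemma runP (b : nat -> bool) : (exists m, ~~ b m) ->
  (forall l, (l < run b)%N -> b l) /\ ~~ b (run b).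
Proof.
move=> h; rewrite /run; case: pselect => // {}h.
case: ex_minnP => m bm hm; split=> // l lm.
by apply/negPn/negP => /hm; rewrite leqNgt lm.
Qed.

Lemma run_eq (b : nat -> bool) r : (forall l, (l < r)%N -> b l) -> ~~ b r ->
  run b = r.
Proof.
move=> h1 h2; have [h3 h4] : (forall l, (l < run b)%N -> b l) /\ ~~ b (run b).
  by apply: runP; exists r.
apply/eqP; rewrite eqn_leq; apply/andP; split; rewrite leqNgt; apply/negP.
  by move=> /h3; apply/negP.
by move=> /h1; apply/negP.
Qed.

Lemma fiber_run (d : measure_display) (T : measurableType d)
    (b : nat -> T -> bool) : (forall m, fiber_measurable (b m)) ->
  fiber_measurable (fun w => run (b^~ w)).
Proof.
move=> mb r.
rewrite (_ : [set w | _] = [set w | (forall l, (l < r)%N -> b l w = true) /\ b r w = false] `|`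
   ([set w | forall m, b m w = true] `&` [set w | r = 0%N])).
  apply: measurableU; apply: measurableI.
  - apply: measurable_forall_count => l; apply: measurable_imply => _; exact: mb.
  - exact: mb.
  - by apply: measurable_forall_count => l; exact: mb.
  - exact: measurable_prop.
apply/seteqP; split => w /=.
  have [/runP[h1 h2] <-|h] := pselect (exists m, ~~ b m w).
    by left; split; [exact: h1|exact: negbTE].
  rewrite /run; case: pselect => // _ <-; right; split=> // m.
  by apply/negPn/negP => bm; apply: h; exists m.
move=> [[h1 h2]|[h ->]]; first by apply: run_eq; rewrite ?h2.
rewrite /run; case: pselect => // h'; exfalso.
by case: h' => m; rewrite h.
Qed.

Section bernoulli_runs.
Context (R : realType) (theta : nat -> nat -> R) (d : measure_display)
  (T : measurableType d) (P : probability T R)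
  (B : nat * nat * nat * nat -> {mfun T >-> bool}) (c : R).
Hypotheses (hB : mutually_independent P B) (c1 : c < 1)
  (hPB : forall t i n p, P [set w | B (t, i, n, p) w = true] = (theta p n)%:E)
  (hc : forall p n, theta p n <= c).

Let mB a : fiber_measurable (B a).
Proof. by apply: mfun_fiber. Qed.

Lemma bernoulli_false t i n p :
  P [set w | B (t, i, n, p) w = false] = (1 - theta p n)%:E.
Proof.
rewrite (_ : [set w | _] = ~` [set w | B (t, i, n, p) w = true]).
  by rewrite (probability_setC P (mB _ _)) hPB.
by apply/seteqP; split => w /=; case: (B _ w).
Qed.

Lemma bernoulli_false_io (m : nat) (iota : nat -> 'I_m -> nat * nat * nat * nat) :
  (forall n l n' l', iota n l = iota n' l' -> n = n' /\ l = l') ->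
  {ae P, forall w, exists n, forall l, ~~ B (iota n l) w}.
Proof.
move=> inj.
have := @independent_blocks_occur _ _ _ _ _ _ _ _ hB m iota
  (fun _ _ => [set false]) (1 - c) inj.
move=> /(_ (fun _ _ => I)); rewrite subr_gt0 => /(_ c1) h.
suff : {ae P, forall w, exists n, forall l, [set false] (B (iota n l) w)}.
  by apply: filterS => w [n hn]; exists n => l; rewrite (hn l).
apply: h => n l; case: (iota n l) => [[[t i] n'] p].
by rewrite [leRHS]bernoulli_false lee_fin lerD2l lerN2.
Qed.

(** The dual particle at level [n] and position [p + m] is the original one at level [p + m] and
    position [n], hence the exchanged arguments of [B]. *)
Definition bernoulli_run (t i n p : nat) (w : T) : nat :=
  run (fun m => B (t, i, (p + m)%N, n) w).

Lemma fiber_bernoulli_run t i n p : fiber_measurable (bernoulli_run t i n p).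
Proof. by apply: (@fiber_run _ _ (fun m w => B (t, i, (p + m)%N, n) w)) => m. Qed.

Lemma bernoulli_run_finite : {ae P, forall w, forall t i n p,
  exists m, ~~ B (t, i, (p + m)%N, n) w}.
Proof.
have h (a : nat * nat * nat * nat) :
    {ae P, forall w, exists m, ~~ B (a.1.1.1, a.1.1.2, (a.2 + m)%N, a.1.2) w}.
  have := @bernoulli_false_io 1
    (fun m _ => (a.1.1.1, a.1.1.2, (a.2 + m)%N, a.1.2)).
  move=> /(_ _)/filterS; apply.
    by move=> w [m /(_ ord0) hm]; exists m.
  by move=> n l n' l' [/addnI ->]; rewrite !ord1.
have := ae_foralln_count h; apply: filterS => w hw t i n p.
exact: (hw (t, i, n, p)).
Qed.

(** Runs with distinct [(t, i, n)] use disjoint sets of variables. The index type [K] is general so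
    as to cover both the runs met by the dynamics and their independent copies. *)
Lemma bernoulli_run_law (K : countType) (s : seq K) (t i n p r : K -> nat) :
  uniq s -> {in s &, injective (fun k => (t k, i k, n k))} ->
  P [set w | forall k, k \in s -> bernoulli_run (t k) (i k) (n k) (p k) w = r k] =
  (\prod_(k <- s) ww_weight (env_swap theta) (n k) (p k) (r k))%:E.
Proof.
move=> us inj.
pose s' := [seq (k, l) | k <- s, l <- iota 0 (r k).+1].
pose ix (kl : K * nat) := (t kl.1, i kl.1, (p kl.1 + kl.2)%N, n kl.1).
(* This singleton prescribes a one before [r k] and a zero at [r k], which is why the offsets run
   through [r k] included. *)
pose A (kl : K * nat) : set bool := [set (kl.2 < r kl.1)%N].
have us' : uniq s'.
  apply: allpairs_uniq_dep => // [k _|[k l] [k' l'] _ _ /= [-> ->]//].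
  exact: iota_uniq.
have inj' : {in s' &, injective ix}.
  move=> [k l] [k' l'] /allpairsPdep[k1 [l1 [ks _ [-> ->]]]].
  move=> /allpairsPdep[k2 [l2 [ks' _ [-> ->]]]] [tE iE pE nE].
  have kk : k1 = k2 by apply: inj => //; rewrite tE iE nE.
  by move: pE; rewrite kk => /addnI ->.
transitivity (P [set w | forall kl, kl \in s' -> A kl (B (ix kl) w)]).
  apply: ae_eq_measure.
  - apply: measurable_forall_count => k; apply: measurable_imply => _.
    exact: fiber_bernoulli_run.
  - exact: measurable_seq_preimage.
  (* The default length 0 of an endless run would break the equivalence when [r k = 0]; it occurs on
     a null set only. *)
  apply: filterS bernoulli_run_finite => w hw; split.
    move=> h [k l] /allpairsPdep[k1 [l1 [ks l1r [-> ->]]]] /=.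
    have [h1 h2] := runP (hw (t k1) (i k1) (n k1) (p k1)).
    rewrite -/(bernoulli_run _ _ _ _ w) h// in h1 h2.
    have : (l1 <= r k1)%N by move: l1r; rewrite mem_iota add0n ltnS.
    rewrite leq_eqVlt => /predU1P[->|lr].
      by rewrite /A /ix /= ltnn; exact: negbTE.
    by rewrite /A /ix /= lr; exact: h1.
  move=> h k ks; apply: run_eq => [l lr|].
    have := h (k, l); rewrite /A /ix /= lr; apply.
    by apply/allpairsPdep; exists k, l; rewrite mem_iota add0n leqW.
  have := h (k, r k); rewrite /A /ix /= ltnn => ->//.
  by apply/allpairsPdep; exists k, (r k); rewrite mem_iota add0n ltnSn.
rewrite (mutually_independent_seq hB _ us' inj')//.
rewrite big_allpairs_dep -prodEFin; apply: eq_bigr => k _.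
rewrite -[iota _ _]/(index_iota 0 (r k).+1) big_nat_recr//=.
rewrite /A /ix /= ltnn [X in (_ * X)%E]bernoulli_false /ww_weight EFinM -prodEFin.
congr (_ * _)%E; apply: eq_big_nat => l /= lr.
by rewrite lr hPB.
Qed.

End bernoulli_runs.

Fixpoint seq_step (y : array) (b : nat -> nat -> nat -> bool) (n : nat) : nat -> nat :=
  let prev := if n is n'.+1 then seq_step y b n' else fun=> 0%N in
  fun i => block (fun=> prev) n i (push (fun=> prev) n i (y n i + b i n (y n i))%N).

Lemma seq_stepE y b n i : (i <= n)%N ->
  seq_step y b n i =
  block (seq_step y b) n i (push (seq_step y b) n i (y n i + b i n (y n i))%N).
Proof. by case: n => [|n] //; rewrite leqn0 => /eqP ->. Qed.

Fixpoint seq_path (B : nat * nat * nat * nat -> bool) (x : array) (t : nat) : array :=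
  if t is t'.+1 then seq_step (seq_path B x t') (fun i n p => B (t', i, n, p)) else x.

Lemma fiber_seq_path (d : measure_display) (T : measurableType d)
    (B : nat * nat * nat * nat -> T -> bool) (x : array) :
  (forall a, fiber_measurable (B a)) ->
  forall t n i, fiber_measurable (fun w => seq_path (B^~ w) x t n i).
Proof.
move=> mB; elim=> [|t iht]; first by move=> n i; exact: fiber_cst.
have step n i (pr : nat -> T -> nat) : (forall j, fiber_measurable (pr j)) ->
    fiber_measurable (fun w => let y := seq_path (B^~ w) x t in
      block (fun=> pr^~ w) n i
        (push (fun=> pr^~ w) n i (y n i + B (t, i, n, y n i) w)%N)).
  move=> hpr.
  have hv : fiber_measurable (fun w => let y := seq_path (B^~ w) x t in
       (y n i + B (t, i, n, y n i) w)%N).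
    apply: (fiber_bind (Z := fun m w => (m + B (t, i, n, m) w)%N) (iht n i)) => m.
    exact: (fiber_comp (fun b : bool => (m + b)%N) (mB _)).
  have hp : fiber_measurable (fun w => let y := seq_path (B^~ w) x t in
       push (fun=> pr^~ w) n i (y n i + B (t, i, n, y n i) w)%N).
    rewrite /push; case: (0 < i)%N => //.
    exact: (fiber_comp2 (fun a b => maxn a b.+1) hv (hpr i.-1)).
  rewrite /block; case: (i < n)%N => //.
  exact: (fiber_comp2 minn (hpr i) hp).
elim=> [|n ihn] i; last exact: (step n.+1 i (fun j w => seq_path (B^~ w) x t.+1 n j)).
by apply: (step 0%N i (fun _ _ => 0%N)) => j; exact: fiber_cst.
Qed.

(** * The height map in discrete time *)

Section discrete_time.
Context (R : realType).

Lemma seq_bernoulli_IAstar (theta : nat -> nat -> R) (c : R) (x : array)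
    (d : measure_display) (T : measurableType d) (P : probability T R)
    (B : nat * nat * nat * nat -> {mfun T >-> bool}) (Y : nat -> T -> array) :
  IAstar x -> c < 1 -> (forall p n, theta p n <= c) ->
  mutually_independent P B ->
  (forall t i n p, P [set w | B (t, i, n, p) w = true] = (theta p n)%:E) ->
  (forall w, eq_array (Y 0%N w) x) ->
  (forall w t n i, (i <= n)%N -> Y t.+1 w n i =
     block (Y t.+1 w) n i
       (push (Y t.+1 w) n i (Y t w n i + B (t, i, n, Y t w n i) w)%N)) ->
  {ae P, forall w, forall t, IAstar (Y t w)}.
Proof.
move=> hx c1 hc hB hPB Y0 YS.
have h (a : nat * nat * nat) : {ae P, forall w, exists n, forall l : 'I_a.1.2.+1,
    ~~ B (a.1.1, val l, (n + a.2 + l)%N, val l) w}.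
  apply: (bernoulli_false_io (m := a.1.2.+1)
    (iota := fun n l => (a.1.1, val l, (n + a.2 + l)%N, val l)) hB c1 hPB hc).
  by move=> n l n' l' [/val_inj -> /addIn/addIn ->].
have := ae_foralln_count h; apply: filterS => w hw; elim=> [|t iht].
  case: hx => hx1 hx2; split=> [n k kn|i i1].
    by rewrite !Y0// ?leqW//; exact: hx1.
  have [j hj] := hx2 i i1; exists j => n i_n jn; rewrite Y0//; exact: hj.
apply: (seq_step_IAstar (b := fun i n p => B (t, i, n, p) w) iht); first exact: YS.
move=> i N; have [n hn] := hw (t, i, N); exists (n + N)%N; first exact: leq_addl.
by move=> l li; have := hn (Ordinal (li : (l < i.+1)%N)).
Qed.

Lemma sequential_bernoulli_Hgt (theta : nat -> nat -> R) (c : R) (x : array)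
    (d : measure_display) (T : measurableType d) (P : probability T R)
    (X : nat -> T -> array) :
  IAstar x -> c < 1 -> (forall p n, theta p n <= c) ->
  sequential_bernoulli theta x P X ->
  warren_windridge_geometric (env_swap theta) (Hgt x) P (fun t w => Hgt (X t w)).
Proof.
move=> hx c1 hc [d' [T' [P' [B [Y [hB hPB Y0 YS law]]]]]].
have star := seq_bernoulli_IAstar hx c1 hc hB hPB Y0 YS.
have finite := bernoulli_run_finite hB c1 hPB hc.
have mrun t i n p : fiber_measurable (bernoulli_run B t i n p).
  exact: fiber_bernoulli_run.
pose G0 (a : nat * nat * nat * nat) := bernoulli_run B a.1.1.1 a.1.1.2 a.1.2 a.2.
have G0law : ww_driven (env_swap theta) P' G0.
  split=> [a|s p r us]; first exact: mrun.
  apply: (@bernoulli_run_law _ _ _ _ _ B c hB c1 hPB hc _ s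
    (fun j => j.1.1) (fun j => j.1.2) (fun j => j.2) p r us).
  by move=> [[a1 a2] a3] [[b1 b2] b3] _ _ [-> -> ->].
(* Coding [(i, p)] as a particle subscript makes runs with different [p] use disjoint Bernoulli
   variables. An overlap with the variables that drive [Y] is harmless, since only laws are
   compared. *)
pose key (a : nat * nat * nat * nat) : nat := choice.pickle (a.1.1.2, a.2).
pose g1 a := bernoulli_run B a.1.1.1 (key a) a.1.2 a.2.
have mg1 a : measurable_fun setT (g1 a).
  exact: (@measurable_fibers _ T' _ nat nat id (g1 a) (mrun _ _ _ _)).
pose G1 a : {RV P' >-> nat} := mfun_Sub (mem_set (mg1 a)).
have G1E a w : G1 a w = g1 a w by [].
have keyinj a a' : a.1.1.1 = a'.1.1.1 -> a.1.2 = a'.1.2 -> key a = key a' -> a = a'.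
  move: a a' => [[[t i] n] p] [[[t' i'] n'] p'] /= -> -> /(pcan_inj choice.pickleK).
  by move=> [-> ->].
have G1seq (s : seq (nat * nat * nat * nat)) (r : nat * nat * nat * nat -> nat) : uniq s ->
    P' [set w | forall a, a \in s -> G1 a w = r a] =
    (\prod_(a <- s) ww_weight (env_swap theta) a.1.2 a.2 (r a))%:E.
  move=> us; apply: (@bernoulli_run_law _ _ _ _ _ B c hB c1 hPB hc _ s
    (fun a => a.1.1.1) key (fun a => a.1.2) (fun a => a.2) r us).
  by move=> a a' _ _ [e1 e2 e3]; exact: keyinj.
have G1marg a m : P' [set w | G1 a w = m] = (ww_weight (env_swap theta) a.1.2 a.2 m)%:E.
  have := G1seq [:: a] (fun=> m) isT; rewrite big_seq1 => <-; congr (P' _).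
  apply/seteqP; split => w /= h; last by apply: h; exact: mem_head.
  by move=> a'; rewrite inE => /eqP ->.
have G1ind : mutually_independent P' G1.
  apply: mutually_independent_singletons => s r us; rewrite G1seq// -prodEFin.
  by apply: eq_bigr => a _; rewrite G1marg.
have G1law : ww_driven (env_swap theta) P' (fun a => G1 a).
  split=> [a|s p r us]; first exact: mrun.
  have := G1seq [seq (j, p j) | j <- s] (fun a => r a.1).
  rewrite map_inj_uniq; last by move=> j j' [].
  rewrite big_map => /(_ us) <-; congr (P' _); apply/seteqP; split => w /= h.
    by move=> a /mapP[j js ->]; exact: h.
  by move=> j js; have := h (j, p j); apply; exact: map_f.
(* The definition asks for independent drivers and a recursion valid for every outcome; [G0] fails
   the former and [Hgt Y] guarantees the latter only almost surely. *)
exists d', T', P', G1, (fun t w => ww_path ((fun a => G1 a w)) (Hgt x) t).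
split=> //.
- by move=> w t n i i_n /=; rewrite -ww_pathS.
apply: (eq_law_trans (eq_law_Hgt law)).
apply: eq_law_trans (ww_driven_law _ G0law G1law); last by [].
apply: eq_law_ae.
- by have [_ ? _] := eq_law_Hgt law.
- by apply: process_fiber => t n k _ _; exact: ww_driven_fiber G0law _ _ _.
move=> t0 _; near=> w.
have hstar : forall t, IAstar (Y t w) by near: w.
have hfin : forall t i n p, exists m, ~~ B (t, i, (p + m)%N, n) w by near: w.
move: t0; apply: ww_pathP => [n k kn|t n i i_n].
  exact: Hgt_eq_array.
have [h1 h2] := runP (hfin t i n (push (Hgt (Y t.+1 w)) n i (Hgt (Y t w) n i))).
exact: (seq_step_Hgt (b := fun i n p => B (t, i, n, p) w) (hstar t) (hstar t.+1)
  (YS w t) i_n h1 h2).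
Unshelve. all: by end_near.
Qed.

Lemma warren_windridge_geometric_law (theta : nat -> nat -> R) (x x' : array)
    (d d' : measure_display) (T : measurableType d) (T' : measurableType d')
    (P : probability T R) (P' : probability T' R)
    (X : nat -> T -> array) (X' : nat -> T' -> array) : eq_array x x' ->
  warren_windridge_geometric theta x P X ->
  warren_windridge_geometric theta x' P' X' ->
  eq_law setT P X P' X'.
Proof.
move=> xx'.
have main (x0 : array) (d0 : measure_display) (T0 : measurableType d0)
    (P0 : probability T0 R) (X0 : nat -> T0 -> array) :
    warren_windridge_geometric theta x0 P0 X0 ->
    exists (d1 : measure_display) (T1 : measurableType d1) (P1 : probability T1 R)
      (G : nat * nat * nat * nat -> T1 -> nat), ww_driven theta P1 G /\
      eq_law setT P0 X0 P1 (fun t w => ww_path (G^~ w) x0 t).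
  move=> [d1 [T1 [P1 [G [Y [hG hPG Y0 YS law]]]]]].
  exists d1, T1, P1, G.
  have hGd : ww_driven theta P1 G.
    split=> [a|s p r us]; first exact: mfun_fiber.
    rewrite (mutually_independent_seq hG (K := (nat * nat * nat)%type) (s := s) (iota := fun j => (j, p j))
      (A := fun j => [set r j]))//; last by move=> j j' _ _ [].
    rewrite -prodEFin; apply: eq_bigr => -[[t i] n] _; exact: hPG.
  split=> //; apply: (eq_law_trans law); apply: eq_law_ae.
  - by have [] := law.
  - by apply: process_fiber => t n k _ _; exact: ww_driven_fiber hGd _ _ _.
  move=> t _; apply: aeW => w; apply: (ww_pathP (Y := Y^~ w)); first exact: Y0.
  exact: YS.
move=> /main[d1 [T1 [P1 [G1 [h1 l1]]]]] /main[d2 [T2 [P2 [G2 [h2 l2]]]]].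
exact: (eq_law_trans l1 (eq_law_trans (ww_driven_law xx' h1 h2) (eq_law_sym l2))).
Qed.

Lemma warren_windridge_geometric_Hgt (theta : nat -> nat -> R) (c : R) (x : array)
    (d : measure_display) (T : measurableType d) (P : probability T R)
    (X : nat -> T -> array) :
  IAstar x -> c < 1 -> (forall p n, theta p n <= c) ->
  warren_windridge_geometric theta x P X ->
  sequential_bernoulli (env_swap theta) (Hgt x) P (fun t w => Hgt (X t w)).
Proof.
move=> hx c1 hc hX.
have [d' [T' [P' [G [_ [hG hPG _ _ _]]]]]] := hX.
(* As [G (t, i, p, n)] vanishes with probability [1 - theta n p], its positivity is a Bernoulli
   variable of the swapped environment. These variables merely provide a space carrying [Z]; [X] and
   [Z] are compared in law only. *)
pose b (a : nat * nat * nat * nat) w : bool :=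
  (0 < G (a.1.1.1, a.1.1.2, a.2, a.1.2) w)%N.
have mG a : fiber_measurable (G a) by exact: mfun_fiber.
have mb a : fiber_measurable (b a) by exact: (fiber_comp (fun m => (0 < m)%N) (mG _)).
have mfb a : measurable_fun setT (b a).
  exact: (@measurable_fibers _ T' _ bool bool id (b a) (mb a)).
pose B a : {RV P' >-> bool} := mfun_Sub (mem_set (mfb a)).
have hB : mutually_independent P' B.
  apply: (@mutually_independent_map _ _ _ _ _ _ _ _ _ _ G
    (fun a => (a.1.1.1, a.1.1.2, a.2, a.1.2)) (fun _ m => (0 < m)%N) B hG) => //.
  by move=> [[[t i] n] p] [[[t' i'] n'] p'] [-> -> -> ->].
have hPB t i n p : P' [set w | B (t, i, n, p) w = true] = (env_swap theta p n)%:E.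
  rewrite (_ : [set w | _] = ~` [set w | G (t, i, p, n) w = 0%N]).
    rewrite (probability_setC P' (mG _ _)) hPG big_geq// mul1r addn0 -EFinB.
    by rewrite opprB addrC subrK.
  by apply/seteqP; split => w /=; rewrite /b /= lt0n => /eqP.
pose Z t w := seq_path (fun a => B a w) (Hgt x) t.
have hx' := IAstar_Hgt hx.
have hc' p n : env_swap theta p n <= c by exact: hc.
have ZS w t n i : (i <= n)%N -> Z t.+1 w n i = block (Z t.+1 w) n i
    (push (Z t.+1 w) n i (Z t w n i + B (t, i, n, Z t w n i) w)%N).
  exact: seq_stepE.
have mZ : measurable_process setT Z.
  by apply: process_fiber => t n k _ _; exact: fiber_seq_path.
have star := seq_bernoulli_IAstar hx' c1 hc' hB hPB (fun w => fun _ _ _ => erefl) ZS.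
have seqZ : sequential_bernoulli (env_swap theta) (Hgt x) P' Z.
  exists d', T', P', B, Z; split=> //.
have wwZ := sequential_bernoulli_Hgt hx' c1 hc' seqZ.
have law : eq_law setT P X P' (fun t w => Hgt (Z t w)).
  apply: warren_windridge_geometric_law hX wwZ.
  by move=> n k kn; rewrite HgtK.
exists d', T', P', B, Z; split=> //.
apply: (eq_law_trans (eq_law_Hgt law)); apply: eq_law_ae => //.
  by have [_ ? _] := eq_law_Hgt law.
by move=> t _; apply: filterS star => w hw; exact: HgtK.
Qed.

End discrete_time.

(** * Continuous-time dynamics *)

Section paths.
Context (R : realType).
Implicit Types (f : R -> array) (z : array).

(** Replaces induction over jumps, since there need be no first one; the supremum of the times up to
    which [Q] holds cannot be finite. *)
Lemma real_induction (Q : R -> Prop) : Q 0 ->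
  (forall t, 0 <= t -> (forall s, 0 <= s <= t -> Q s) -> \forall s \near t^'+, Q s) ->
  (forall t, 0 < t -> (forall s, 0 <= s < t -> Q s) -> Q t) ->
  forall t, 0 <= t -> Q t.
Proof.
move=> Q0 Qr Ql t0 t00; apply: contrapT => nQ.
pose S := [set t | 0 <= t /\ forall s, 0 <= s <= t -> Q s].
have S0 : S 0 by split=> // s; rewrite -eq_le => /eqP <-.
have ubS : ubound S t0.
  move=> t [tge0 hS]; rewrite leNgt; apply/negP => tt; apply: nQ.
  by apply: hS; rewrite t00 ltW.
have supS : has_sup S by split; [exists 0|exists t0].
pose m := sup S.
have m0 : 0 <= m by apply: ub_le_sup => //; exists t0.
have Qlt s : 0 <= s < m -> Q s.
  move=> /andP[s0 sm].
  have [t [_ hS] st] := sup_gt supS.1 sm.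
  by apply: hS; rewrite s0 ltW.
have Qm : Q m.
  by move: m0; rewrite le_eqVlt => /predU1P[<-//|m_gt0]; exact: Ql.
have Qle s : 0 <= s <= m -> Q s.
  by move=> /andP[s0]; rewrite le_eqVlt => /predU1P[->//|sm]; apply: Qlt; rewrite s0.
have := Qr m m0 Qle; rewrite /at_right near_withinE => -[e /= e0 he].
have : S (m + e / 2).
  split; first by rewrite addr_ge0// divr_ge0// ltW.
  move=> s /andP[s0 sm].
  have [sm'|ms] := leP s m; first by apply: Qle; rewrite s0.
  apply: he => //=.
  rewrite distrC ger0_norm; last by rewrite subr_ge0 ltW.
  by rewrite ltrBlDl (le_lt_trans sm)// ltrD2l ltr_pdivrMr// ltr_pMr// ltr1n.
move=> /(ub_le_sup (ex_intro _ t0 ubS)); rewrite -/m gerDl leNgt.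
by rewrite divr_gt0.
Qed.

Lemma near_levels (F : set_system R) {FF : Filter F} f z N :
  (forall n k, (k <= n)%N -> \forall s \near F, f s n k = z n k) ->
  \forall s \near F, forall n k, (n <= N)%N -> (k <= n)%N -> f s n k = z n k.
Proof.
move=> h.
have : \forall s \near F, forall a : 'I_N.+1 * 'I_N.+1,
    (val a.2 <= val a.1)%N -> f s (val a.1) (val a.2) = z (val a.1) (val a.2).
  apply: filter_forall => -[a b]; have [ba|ba] := boolP (val b <= val a)%N.
    by apply: filterS (h _ _ ba).
  exact: nearW.
apply: filterS => s hs n k nN kn.
have nN' : (n < N.+1)%N by [].
have kN' : (k < N.+1)%N by rewrite (leq_ltn_trans kn).
exact: (hs (Ordinal nN', Ordinal kN') kn).
Qed.

Lemma IA_upto_eq N (y z : array) :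
  (forall n k, (n <= N)%N -> (k <= n)%N -> y n k = z n k) ->
  IA_upto N y -> IA_upto N z.
Proof.
move=> yz hy n k nN kn; rewrite -!yz ?ltnS//; first exact: hy.
- exact: ltnW.
- exact: leqW.
Qed.

Lemma eq_left_limit f t z z' : left_limit f t z -> left_limit f t z' -> eq_array z z'.
Proof.
move=> h h' n k kn.
have : \forall s \near t^'-, z n k = z' n k.
  by apply: filterS2 (h n k kn) (h' n k kn) => s <- <-.
by move=> /filter_ex[].
Qed.

Lemma near_left_le (t : R) : 0 < t -> \forall s \near t^'-, 0 <= s < t.
Proof.
move=> t0; near=> s; apply/andP; split; near: s; last exact: nbhs_left_lt.
exact: nbhs_left_ge.
Unshelve. all: by end_near.
Qed.

Section pure_birth_paths.
Context (clk : nat * nat * nat * nat -> R) (x : array) (f : R -> array).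
Hypothesis hf : pure_birth_path clk x f.

Lemma pure_birth_path_step t : 0 < t -> exists2 z, left_limit f t z &
  eq_array (f t) z \/ exists n i, [/\ (i <= n)%N, rings_at clk i n (z n i) t &
    eq_array (f t) (pb_jump z n i)].
Proof.
move=> t0; have [[_ /(_ t t0)[z hz]] _ hS] := hf.
exists z => //; have [h1 h2] := hS t z t0 hz.
have [[n [i [i_n r]]]|no] := pselect (exists n i, (i <= n)%N /\ rings_at clk i n (z n i) t).
  by right; exists n, i; split=> //; exact: h1.
by left; apply: h2 => n i i_n r; apply: no; exists n, i.
Qed.

Lemma pure_birth_path_right t n k : 0 <= t -> (k <= n)%N ->
  \forall s \near t^'+, f s n k = f t n k.
Proof. by case: hf => -[h _] _ _; exact: h. Qed.

Lemma pure_birth_path_mono s t n k : 0 <= s -> s <= t -> (k <= n)%N ->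
  (f s n k <= f t n k)%N.
Proof.
move=> s0 st kn; have t0 := le_trans s0 st; move: t t0 st.
apply: real_induction => [s0'|t t0 h|t t0 h].
- by have -> : s = 0 by apply/eqP; rewrite eq_le s0 s0'.
- have hr := pure_birth_path_right t0 kn.
  have [st|ts] := leP s t.
    by apply: filterS hr => u -> _; apply: h => //; rewrite t0 lexx.
  near=> u => su; have : u < s by near: u; exact: nbhs_right_lt.
  by rewrite ltNge su.
- rewrite le_eqVlt => /predU1P[->//|st].
  have [z hz hstep] := pure_birth_path_step t0.
  have : (f s n k <= z n k)%N.
    have [u [/andP[u0 ut] su uz]] : exists u, [/\ 0 <= u < t, s <= u & f u n k = z n k].
      apply: (@filter_ex _ t^'-); near=> u; split; near: u.
      + exact: near_left_le.
      + exact: nbhs_left_ge.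
      + exact: hz.
    by rewrite -uz; apply: h => //; rewrite u0.
  move/leq_trans; apply; case: hstep => [->//|[m [i [im _ ->//]]]].
  exact: leq_pb_jump.
Unshelve. all: by end_near.
Qed.

Lemma pure_birth_path_IA t : IA x -> 0 <= t -> IA (f t).
Proof.
move=> hx t0; apply/IA_uptoP => N; move: t t0; apply: real_induction => [|t t0 h|t t0 h].
- have [_ f0 _] := hf; move/IA_uptoP : hx => /(_ N); apply: IA_upto_eq => n k _ kn.
  by rewrite f0.
- have := near_levels (F := t^'+) (z := f t) N (fun n k kn => @pure_birth_path_right t n k t0 kn).
  move=> hr; near=> s; have := h t; rewrite lexx t0 => /(_ isT).
  apply: IA_upto_eq => n k nN kn; apply/esym; move: n k nN kn.
  by near: s; exact: hr.
have [z hz hstep] := pure_birth_path_step t0.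
have IAz : IA_upto N z.
  have [s [st sz]] : exists s, 0 <= s < t /\
      forall n k, (n <= N)%N -> (k <= n)%N -> f s n k = z n k.
    apply: (@filter_ex _ t^'-); near=> s; split; near: s.
      exact: near_left_le.
    exact: near_levels.
  exact: IA_upto_eq sz (h s st).
case: hstep => [fz|[m [i [im _ fz]]]].
  by apply: IA_upto_eq IAz => n k _ kn; rewrite fz.
by apply: IA_upto_eq (pb_jump_IA_upto im IAz) => n k _ kn; rewrite fz.
Unshelve. all: by end_near.
Qed.

(** As in discrete time, the particles of a diagonal at their lowest positions are pushed only by
    one another, so silent clocks freeze the diagonal. *)
Lemma pure_birth_path_stay (i m : nat) (tmax : R) :
  (forall l, (l <= i)%N -> x (m + l)%N l = l) ->
  (forall l t, (l <= i)%N -> t <= tmax -> ~ rings_at clk l (m + l)%N l t) ->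
  forall t, 0 <= t -> t <= tmax -> forall l, (l <= i)%N -> f t (m + l)%N l = l.
Proof.
move=> hx hclk; apply: real_induction => [_ l li|t t0 h|t t0 h tT l li].
- by have [_ f0 _] := hf; rewrite (f0 _ _ (leq_addl m l)) hx.
- have := near_levels (F := t^'+) (z := f t) (m + i)%N
    (fun n k kn => @pure_birth_path_right t n k t0 kn).
  move=> hr; near=> s => sT l li.
  have hs : forall n k, (n <= m + i)%N -> (k <= n)%N -> f s n k = f t n k.
    by near: s; exact: hr.
  rewrite hs ?leq_add2l ?leq_addl//; apply: h => //; first by rewrite t0 lexx.
  by apply: le_trans sT; apply: ltW; near: s; exact: nbhs_right_gt.
have [z hz hstep] := pure_birth_path_step t0.
have zE l' : (l' <= i)%N -> z (m + l')%N l' = l'.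
  move=> li'; have [s [st sz]] : exists s, 0 <= s < t /\ f s (m + l')%N l' = z (m + l')%N l'.
    apply: (@filter_ex _ t^'-); near=> s; split; near: s.
      exact: near_left_le.
    by apply: hz; exact: leq_addl.
  rewrite -sz; apply: h => //.
  by apply: le_trans tT; case/andP: st => _ /ltW.
case: hstep => [->|[n [k [kn r ->]]]]; rewrite ?leq_addl//; first exact: zE.
rewrite /pb_jump; case: ifP => _; first exact: zE.
case: ifPn => [/pb_movesP[L [nE lE hL]]|_]; last exact: zE.
(* A run keeps the difference of level and subscript, so a push reaching the diagonal was started on
   it. *)
have nE' : n = (m + k)%N by lia.
have ki : (k <= i)%N by lia.
by exfalso; apply: (hclk k t ki tT); move: r; rewrite nE' zE.
Unshelve. all: by end_near.
Qed.

End pure_birth_paths.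

Definition good_path f := [/\ cadlag f,
  forall s t n k, 0 <= s -> s <= t -> (k <= n)%N -> (f s n k <= f t n k)%N &
  forall t, 0 <= t -> IAstar (f t)].

(** Entrywise convergence does not control [Hgt], which reads all levels. The bound by [y] makes
    coordinate [k] stable from one common level on, leaving finitely many levels to compare. *)
Lemma Hgt_near (F : set_system R) {FF : ProperFilter F} f z (y : array) :
  (forall n k, (k <= n)%N -> \forall s \near F, f s n k = z n k) ->
  IAstar y ->
  (\forall s \near F, IAstar (f s) /\ forall n k, (k <= n)%N -> (f s n k <= y n k)%N) ->
  IAstar z /\ forall n k, (k <= n)%N -> \forall s \near F, Hgt (f s) n k = Hgt z n k.
Proof.
move=> hz hy hF.
have stable i n : (i <= n)%N -> y n i = i -> \forall s \near F, forall m, (n <= m)%N ->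
    f s m i = i.
  move=> i_n yn; apply: filterS hF => s [[hs _] sy] m nm.
  apply/eqP; rewrite eqn_leq IA_ge ?(leq_trans i_n)// andbT.
  rewrite -[leqRHS]yn; apply: leq_trans (sy _ _ i_n).
  exact: IA_mono.
have starz : IAstar z.
  apply: IAstarP.
    apply/IA_uptoP => N.
    have [s [[[hs _] _] sz]] : exists s,
      (IAstar (f s) /\ forall n k, (k <= n)%N -> (f s n k <= y n k)%N)
      /\ forall n k, (n <= N)%N -> (k <= n)%N -> f s n k = z n k.
      by apply: (@filter_ex _ F); near=> s; split; near: s => //; exact: near_levels.
    exact: IA_upto_eq sz (iffLR (IA_uptoP _) hs N).
  move=> i; have [n i_n hn] := IAstar_stable hy i; exists n => //.
  have [s [sz sn]] : exists s, f s n i = z n i /\ forall m, (n <= m)%N -> f s m i = i.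
    apply: (@filter_ex _ F); near=> s; split; near: s; first exact: hz.
    by apply: stable => //; exact: hn.
  by rewrite -sz sn.
split=> // n k kn.
have [N kN hN] := IAstar_stable hy k.
have [M kM hM] := IAstar_stable starz k.
near=> s.
have s1 : forall m, (N <= m)%N -> f s m k = k.
  by near: s; apply: stable => //; exact: hN.
have s2 : forall m i, (m <= maxn N M)%N -> (i <= m)%N -> f s m i = z m i.
  by near: s; exact: near_levels.
rewrite /Hgt /hgt_fun; congr (_ + _)%N; congr (#|` fset_set _|%fset).
have E m : (k <= m)%N -> f s m k = z m k.
  move=> km; have [mN|Nm] := leqP m (maxn N M); first exact: s2.
  by rewrite s1 ?hM//; move: (ltnW Nm); rewrite geq_max => /andP[].
by apply/seteqP; split => m /= [km]; rewrite E.
Unshelve. all: by end_near.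
Qed.

Lemma good_path_left_limit f t z : good_path f -> 0 < t -> left_limit f t z ->
  IAstar z /\ left_limit (fun s => Hgt (f s)) t (Hgt z).
Proof.
move=> [_ hm hs] t0 hz; apply: (@Hgt_near _ _ f z (f t)) => //.
  exact: hs (ltW t0).
apply: filterS (near_left_le t0) => s /andP[s0 st]; split; first exact: hs.
by move=> n k kn; apply: hm => //; exact: ltW.
Qed.

Lemma cadlag_Hgt f : good_path f -> cadlag (fun t => Hgt (f t)).
Proof.
move=> hf; have [[hr hl] hm hs] := hf; split=> [t n k t0 kn|t t0].
  (* By monotonicity the path just after [t] is dominated by its value at the later time [t + 1]. *)
  have [] := @Hgt_near t^'+ _ f (f t) (f (t + 1)) _ _ _; last by move=> _; exact.
  - by move=> n' k'; exact: hr.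
  - by apply: hs; rewrite addr_ge0.
  near=> s; have ts : t < s by near: s; exact: nbhs_right_gt.
  have st : s < t + 1 by near: s; apply: nbhs_right_lt; rewrite ltrDl.
  have s0 : 0 <= s by rewrite (le_trans t0)// ltW.
  split; first exact: hs.
  by move=> n' k' kn'; apply: hm => //; exact: ltW.
have [z hz] := hl t t0; exists (Hgt z).
by have [] := good_path_left_limit hf t0 hz.
Unshelve. all: by end_near.
Qed.

Definition clk_swap (clk : nat * nat * nat * nat -> R) (a : nat * nat * nat * nat) :=
  let: (i, n, p, l) := a in clk (i, p, n, l).

Lemma pure_birth_path_Hgt (clk : nat * nat * nat * nat -> R) (x : array) f :
  (forall a b t, rings_at clk a.1.1 a.1.2 a.2 t -> rings_at clk b.1.1 b.1.2 b.2 t -> a = b) ->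
  good_path f -> pure_birth_path clk x f ->
  pure_birth_path (clk_swap clk) (Hgt x) (fun t => Hgt (f t)).
Proof.
move=> uniq_ring hg hf; have [_ f0 hS] := hf; split; first exact: cadlag_Hgt.
  by move=> n k kn; exact: Hgt_eq_array.
move=> t z' t0 hz'.
have [z hz] : exists z, left_limit f t z by case: hf => -[_ h] _ _; exact: h.
have [starz hHz] := good_path_left_limit hg t0 hz.
have zz' := eq_left_limit hz' hHz.
have [h1 h2] := hS t z t0 hz.
have [IAz _] := starz.
split=> [n i i_n|no].
  rewrite zz'// => ring.
  have {}ring : rings_at clk i (Hgt z n i) n t by [].
  set p := Hgt z n i in ring *.
  have ip : (i <= p)%N by exact: Hgt_ge.
  have jE := pb_jump_eq_array i_n zz'.
  have [zp|zp] := eqVneq (z p i) n.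
    have ft := h1 p i ip; rewrite zp in ft; move/(_ ring) : ft => ft m k km.
    rewrite (Hgt_eq_array ft) jE//.
    have ub : ~~ pb_blocked z p i.
      apply/negP => /andP[i_p /eqP e].
      have : (p.-1 < Hgt z n i)%N by rewrite -/p; lia.
      by rewrite HgtP// ?e ?zp ?ltnn//; lia.
    by rewrite (Hgt_pb_jump starz ip ub)// zp.
  (* The ringing clock belongs to a site without particle, and no other clock rings simultaneously,
     so nothing moves; the dual particle has to be blocked. *)
  have ft : eq_array (f t) z.
    apply: h2 => m k km r.
    have [ki nz mp] := uniq_ring (i, p, n) (k, m, z m k) t ring r.
    by move: zp; rewrite nz mp ki eqxx.
  move=> m k km; rewrite (Hgt_eq_array ft) jE//.
  have bl : pb_blocked (Hgt z) n i.
    have zpn : (z p i < n)%N.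
      by rewrite ltn_neqAle zp leqNgt -HgtP// ltnn.
    have i_ltn : (i < n)%N by have := IA_ge IAz ip; lia.
    rewrite /pb_blocked i_ltn -/p /= eqn_leq; apply/andP; split.
      by rewrite leqNgt HgtP//; lia.
    by have [IAh _] := IAstar_Hgt starz; rewrite /p; apply: IA_mono => //; lia.
  by rewrite /pb_jump bl.
(* The ring of an unblocked particle would also be a ring for its dual, so any original clock
   ringing now is blocked. *)
have ft : eq_array (f t) z.
  have [[m [k [km r]]]|no'] := pselect (exists m k, (k <= m)%N /\ rings_at clk k m (z m k) t).
    have ft := h1 m k km r.
    have [bl|ub] := boolP (pb_blocked z m k); first by move: ft; rewrite /pb_jump bl.
    have [E _] := Hgt_unblocked starz km ub.
    have kz : (k <= z m k)%N by exact: IA_ge.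
    exfalso; apply: (no (z m k) k kz); rewrite zz'// E.
    exact: r.
  by apply: h2 => m k km r; apply: no'; exists m, k.
by move=> m k km; rewrite (Hgt_eq_array ft) zz'.
Qed.

End paths.

(** * Exponential clocks and their ringing times *)

Section exponential.
Context (R : realType).
Local Open Scope ereal_scope.

Lemma exponential_prob_le (rate : R) (A : set R) : (0 < rate)%R -> measurable A ->
  exponential_prob rate A <= rate%:E * lebesgue_measure (A `&` `[0%R, +oo[).
Proof.
move=> r0 mA; rewrite /exponential_prob.
have mI : measurable (A `&` `[0%R, +oo[) by exact: measurableI.
apply: (@le_trans _ _ (\int[lebesgue_measure]_(x in A) ((cst rate \_ `[0%R, +oo[) x)%:E)).
  apply: ge0_le_integral => //.
  - by move=> x _; rewrite lee_fin exponential_pdf_ge0// ltW.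
  - apply/measurable_EFinP; apply: measurable_funTS.
    exact: measurable_exponential_pdf.
  - apply/measurable_EFinP; apply: measurable_funTS.
    exact: (measurable_restrictT (cst rate) (measurable_itv _)).1.
  move=> x _; rewrite lee_fin /exponential_pdf /patch; case: ifPn => // .
  rewrite inE /= in_itv /= andbT => x0.
  by rewrite ger_pMr// -expR0 ler_expR mulNr oppr_le0 mulr_ge0// ltW.
under eq_integral => x _ do rewrite -/((EFin \o (cst rate \_ `[0%R, +oo[)) x) -restrict_EFin.
rewrite -integral_mkcondr/= integral_cst//.
Qed.

Lemma exponential_prob_itv (rate a b : R) : (0 < rate)%R -> (a <= b)%R ->
  exponential_prob rate `[a, b] <= (rate * (b - a))%:E.
Proof.
move=> r0 ab; apply: (le_trans (exponential_prob_le r0 _)) => //.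
rewrite EFinM; apply: lee_wpmul2l; first by rewrite lee_fin ltW.
apply: (@le_trans _ _ (lebesgue_measure `[a, b])).
  by apply: le_measure; rewrite ?inE//; exact: measurableI.
rewrite lebesgue_measure_itv /= lte_fin; case: ifPn => // _.
by rewrite lee_fin subr_ge0.
Qed.

Lemma exponential_prob_npos (rate : R) : (0 < rate)%R ->
  exponential_prob rate `]-oo, 0%R] <= 0.
Proof.
move=> r0; apply: (le_trans (exponential_prob_le r0 _)) => //.
rewrite (_ : _ `&` _ = [set 0%R]) ?lebesgue_measure_set1 ?mule0//.
apply/seteqP; split => x /=; rewrite !in_itv /= ?andbT.
  by move=> [x0 x0']; apply/eqP; rewrite eq_le x0 x0'.
by move=> ->.
Qed.

End exponential.

Section no_coincidence.
Context (R : realType) (d : measure_display) (T : measurableType d)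
  (P : probability T R).
Local Open Scope ereal_scope.

Lemma conditional_bound (C : countType) (D : T -> C) (E : set T) (a : R) :
  (0 <= a)%R -> measurable E -> fiber_measurable D ->
  (forall c, P (E `&` [set w | D w = c]) <= a%:E * P [set w | D w = c]) ->
  P E <= a%:E.
Proof.
move=> a0 mE mD h.
have ET : E = E `&` [set w | setT (D w)] by apply/seteqP; split => w //= -[].
rewrite ET (total_probability P setT mE mD).
have := total_probability P setT measurableT mD.
rewrite setTI (_ : [set w | setT (D w)] = setT)// probability_setT => h1.
rewrite -[leRHS]mule1 h1 -nneseriesZl//.
apply: lee_nneseries => [k _ _|k]; first exact: measure_ge0.
rewrite inE => -[c ck _].
by rewrite !setTI (pickle_fiber _ ck).
Qed.

Context (I : choiceType) (xi : I -> {mfun T >-> R}).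
Hypothesis hxi : mutually_independent P xi.

(* The other variables are discretized with mesh [e]; given their cells, the
   variable [xi i0] has to lie in an interval of length [2 m e]. *)
Lemma no_coincidence (m : nat) (i0 : I) (iota : 'I_m -> I) (c : 'I_m -> R) (C : R) :
  (0 <= C)%R -> injective iota -> (forall l, iota l != i0) -> (forall l, `|c l| <= 1)%R ->
  (forall a b, (a <= b)%R -> P [set w | xi i0 w \in `[a, b]] <= (C * (b - a))%:E) ->
  {ae P, forall w, xi i0 w != \sum_l c l * xi (iota l) w}%R.
Proof.
move=> C0 inj ni0 c1 hC.
pose E := [set w | xi i0 w = \sum_l c l * xi (iota l) w]%R.
have mE : measurable E.
  have mf : measurable_fun setT (fun w => xi i0 w - \sum_l c l * xi (iota l) w)%R.
    apply: measurable_funB => //; apply: measurable_sum => l.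
    exact: measurable_funM.
  have := mf measurableT _ (measurable_set1 0%R); rewrite setTI.
  congr measurable; apply/seteqP; split => w /=; first by move/subr0_eq.
  by move=> ->; rewrite subrr.
have bound (e : R) : (0 < e)%R -> P E <= (C * (2 * m%:R * e))%:E.
  move=> e0.
  pose D w : {ffun 'I_m -> int} := [ffun l => Num.floor (xi (iota l) w / e)].
  pose cell (k : int) : set R := `[(e * k%:~R)%R, (e * (k + 1)%:~R)%R[%classic.
  have cellP r k : cell k r <-> Num.floor (r / e) = k.
    rewrite /cell /= in_itv /= ![(e * _)%R]mulrC -ler_pdivlMr// -ltr_pdivrMr//.
    by split=> [/floor_def|<-]; last exact: floor_itv.
  have mD : fiber_measurable D.
    apply: fiber_ffun => l k.
    rewrite (_ : [set w | _] = xi (iota l) @^-1` cell k).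
      exact: (measurable_funPTI (xi (iota l)) (measurable_itv _)).
    by apply/seteqP; split => w /cellP.
  have m0 : (0 <= m%:R :> R)%R by [].
  have e0' := ltW e0.
  apply: (@conditional_bound _ D) => // [|g]; first by rewrite !mulr_ge0.
  pose a := (\sum_l c l * (e * (g l)%:~R))%R.
  pose io (k : option 'I_m) : I := if k is Some l then iota l else i0.
  pose A (k : option 'I_m) : set R := if k is Some l then cell (g l)
    else [set` `[a - m%:R * e, a + m%:R * e]%R].
  have mA k : measurable (A k) by case: k => [l|]; exact: measurable_itv.
  have ioinj : injective io.
    move=> [l|] [l'|] //= e'; first by rewrite (inj _ _ e').
      by have := ni0 l; rewrite e' eqxx.
    by have := ni0 l'; rewrite -e' eqxx.
  have DE : [set w | D w = g] =
      [set w | forall k, k \in [seq Some l | l <- enum 'I_m] -> A k (xi (io k) w)].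
    apply/seteqP; split => w /=.
      by move=> Dw _ /mapP[l _ ->]; apply/cellP; rewrite -Dw ffunE.
    move=> h; apply/ffunP => l; rewrite ffunE; apply/cellP.
    by apply: (h (Some l)); rewrite map_f// mem_enum.
  have us : uniq [seq Some l | l <- enum 'I_m].
    by rewrite map_inj_uniq ?enum_uniq// => l l' [].
  apply: (@le_trans _ _ (P [set w | forall k,
      k \in None :: [seq Some l | l <- enum 'I_m] -> A k (xi (io k) w)])).
    apply: le_measure; rewrite ?inE.
    - by apply: measurableI => //; exact: mD.
    - exact: measurable_seq_preimage.
    move=> w [/= Ew Dw] k; rewrite inE => /predU1P[->|]; last first.
      by move: k; have : [set w | D w = g] w by []; rewrite DE.
    (* Each of the [m] variables is within [e] of the left end of its cell and has a coefficient of
       modulus at most one, so their combination is within [m e] of [a]. *)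
    rewrite /A /= in_itv /= -ler_distl Ew -sumrB.
    apply: (le_trans (ler_norm_sum _ _ _)).
    rewrite -[in leRHS](card_ord m) -sum1_card natr_sum mulr_suml.
    apply: ler_sum => l _; rewrite mul1r -mulrBr normrM.
    rewrite -[leRHS]mul1r; apply: ler_pM => //.
    have /cellP : Num.floor (xi (iota l) w / e) = g l by rewrite -Dw ffunE.
    rewrite /cell /= in_itv /= intrD mulrDr mulr1 => /andP[h1 h2].
    by rewrite ger0_norm ?subr_ge0// lerBlDl ltW.
  rewrite (mutually_independent_seq hxi) /=; [|by []| |by move=> ? ? _ _; exact: ioinj]; last first.
    by rewrite us andbT; apply/mapP => -[].
  rewrite big_cons DE (mutually_independent_seq hxi)//; last by move=> ? ? _ _; exact: ioinj.
  apply: lee_wpmul2r; first by apply: prode_ge0 => k _; exact: measure_ge0.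
  rewrite /=; apply: (le_trans (hC _ _ _)).
    by rewrite lerD2l ge0_cp// mulr_ge0// ltW.
  rewrite lee_fin [leLHS](_ : _ = C * (2 * m%:R * e))%R//; ring.
exists E; split=> //; last by move=> w /negP; rewrite negbK => /eqP.
apply/eqP; rewrite eq_le measure_ge0 andbT.
apply/lee_addgt0Pr => e e0; rewrite add0e.
(* The added 1 keeps the divisor positive when [C] or [m] is zero. *)
have k0 : (0 < C * (2 * m%:R) + 1)%R by rewrite ltr_wpDl// mulr_ge0// mulr_ge0.
apply: (le_trans (bound _ (divr_gt0 e0 k0))).
rewrite lee_fin [leLHS]mulrA [leLHS]mulrA ler_pdivrMr// mulrC ler_pM2l//.
by rewrite lerDl.
Qed.

End no_coincidence.

Section clocks.
Context (R : realType) (theta : nat -> nat -> R) (d : measure_display)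
  (T : measurableType d) (P : probability T R)
  (clk : nat * nat * nat * nat -> {RV P >-> R}).
Hypotheses (theta0 : forall p n, 0 < theta p n) (hclk : exponential_clocks theta clk).

Lemma clocks_le0 i n p l : P [set w | clk (i, n, p, l) w <= 0] = 0%E.
Proof.
apply/eqP; rewrite eq_le measure_ge0 andbT.
apply: le_trans (exponential_prob_npos (theta0 p n)).
by rewrite -(proj2 hclk i n p l).
Qed.

Lemma clocks_gt0 : {ae P, forall w, forall a, 0 < clk a w}.
Proof.
apply: ae_foralln_count => -[[[i n] p] l].
exists [set w | clk (i, n, p, l) w <= 0]; split; last 2 first.
- exact: clocks_le0.
- by move=> w /= /negP; rewrite -leNgt.
have := measurable_funPTI (clk (i, n, p, l)) (measurable_itv `]-oo, 0]).
by congr measurable; apply/seteqP; split => w /=; rewrite in_itv.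
Qed.

Lemma clocks_tail (M t : R) i n p l : (forall p n, theta p n <= M) -> 0 < t ->
  ((expR (- M * t))%:E <= P [set w | (t < clk (i, n, p, l) w)%R])%E.
Proof.
move=> hM t0.
have mI (J : interval R) : measurable (clk (i, n, p, l) @^-1` [set` J]).
  exact: (measurable_funPTI _ (measurable_itv J)).
have PI : P (clk (i, n, p, l) @^-1` `[0, t]) = (1 - (expR (- theta p n * t))%:E)%E.
  have := proj2 hclk i n p l _ (measurable_itv `[0, t]).
  by rewrite /distribution /pushforward => ->; rewrite exponential_prob_itv0c.
(* The exponential law is evaluated on [[0, t]] only, so the null event of nonpositive times is
   split off. *)
pose A := clk (i, n, p, l) @^-1` `]-oo, 0].
have PA : P A = 0%E by exact: clocks_le0.
have -> : [set w | t < clk (i, n, p, l) w] =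
    ~` (clk (i, n, p, l) @^-1` `[0, t] `|` A).
  apply/seteqP; split => w /=; rewrite /A /= !in_itv /=.
    move=> tw [/andP[_]|]; rewrite leNgt ?tw//.
    by rewrite (lt_trans t0 tw).
  move=> h; rewrite ltNge; apply/negP => wt; apply: h.
  have [w0|w0] := leP 0 (clk (i, n, p, l) w); [left|right].
    by rewrite wt.
  exact: ltW.
have PU : (P (clk (i, n, p, l) @^-1` `[0%R, t] `|` A) <= 1 - (expR (- theta p n * t))%:E)%E.
  have : (P (clk (i, n, p, l) @^-1` `[0%R, t] `|` A) <=
      P (clk (i, n, p, l) @^-1` `[0%R, t]) + P A)%E.
    exact: (measureU2 P (mI `[0, t]) (mI `]-oo, 0])).
  by rewrite PI PA adde0.
have mU : measurable (clk (i, n, p, l) @^-1` `[0, t] `|` A).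
  by apply: measurableU; exact: mI.
rewrite (probability_setC P mU).
move: PU; rewrite -(fineK (fin_num_measure P _ mU)) -!EFinB !lee_fin => PU.
rewrite lerBrDl -lerBrDr; apply: (le_trans PU); rewrite lerD2l lerN2 ler_expR.
by rewrite !mulNr lerN2 ler_pM2r.
Qed.

(** Provides a diagonal that is silent until [t]: the bound [M] on the rates keeps each probability
    of silence above [expR (- M * t)], whatever the level. *)
Lemma clocks_block (M t : R) (i m : nat) : (forall p n, theta p n <= M) -> 0 < t ->
  {ae P, forall w, exists n, forall l : 'I_i.+1,
    t < clk (val l, (n + m + l)%N, val l, 0%N) w}.
Proof.
move=> hM t0.
have := @independent_blocks_occur _ _ _ _ _ _ _ _ (proj1 hclk) i.+1
  (fun n l => (val l, (n + m + l)%N, val l, 0%N)) (fun _ _ => `]t, +oo[%classic)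
  (expR (- M * t)).
move=> h.
suff : {ae P, forall w, exists n, forall l : 'I_i.+1,
    `]t, +oo[%classic (clk (val l, (n + m + l)%N, val l, 0%N) w)}.
  apply: filterS => w [n hn]; exists n => l.
  by have := hn l; rewrite /= in_itv /= andbT.
apply: h => [n l n' l'|_ _||n l].
- by move=> [/val_inj -> /addIn/addIn ->].
- exact: measurable_itv.
- exact: expR_gt0.
apply: (le_trans (clocks_tail (val l) (n + m + l) (val l) 0 hM t0)).
rewrite le_eqVlt; apply/orP; left; apply/eqP; congr (P _).
by apply/seteqP; split => w /=; rewrite in_itv /= andbT.
Qed.

Lemma clocks_no_coincidence : {ae P, forall w, forall a b t,
  rings_at (fun c => clk c w) a.1.1 a.1.2 a.2 t ->
  rings_at (fun c => clk c w) b.1.1 b.1.2 b.2 t -> a = b}.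
Proof.
suff h (k : (nat * nat * nat) * (nat * nat * nat) * nat * nat) :
    {ae P, forall w, k.1.1.1 != k.1.1.2 ->
     \sum_(0 <= j < k.1.2.+1) clk (k.1.1.1, j) w !=
     \sum_(0 <= j < k.2.+1) clk (k.1.1.2, j) w}.
  have := ae_foralln_count h; apply: filterS => w hw a b t [l ->] [l' e].
  apply/eqP/negPn/negP => ab; have /eqP := hw (a, b, l, l') ab; apply.
  by move: a b e {ab} => [[a1 a2] a3] [[b1 b2] b3].
case: k => [[[a b] l] l'] /=; have [->|ab] := eqVneq a b; first exact: aeW.
(* The coincidence is solved for the first waiting time of [a]: it is the sum of the waiting times
   of [b] minus the later ones of [a], all distinct from it because [a != b]. *)
pose io (q : 'I_(l + l'.+1)) :=
  match fintype.split q with inl j => (a, j.+1) | inr j => (b, val j) end.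
pose c (q : 'I_(l + l'.+1)) : R :=
  match fintype.split q with inl j => -1 | inr j => 1 end.
have ioinj : injective io.
  move=> q q'; rewrite /io -[q]splitK -[q']splitK; case: (fintype.split q) => j;
    case: (fintype.split q') => j'; rewrite !unsplitK => -[].
  - by move/val_inj ->.
  - by move=> e; rewrite e eqxx in ab.
  - by move=> e; rewrite e eqxx in ab.
  - by move/val_inj ->.
have ion q : io q != (a, 0%N).
  rewrite /io; case: fintype.split => j; first by rewrite xpair_eqE andbF.
  by rewrite xpair_eqE eq_sym (negbTE ab).
have c1 q : `|c q| <= 1 by rewrite /c; case: fintype.split => j; rewrite ?normrN normr1.
have bnd x y : x <= y ->
    (P [set w | clk (a, 0%N) w \in `[x, y]] <= (theta a.2 a.1.2 * (y - x))%:E)%E.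
  move=> xy; case: a {io c ioinj ion c1 ab} => [[a1 a2] a3] /=.
  have := exponential_prob_itv (theta0 a3 a2) xy.
  by rewrite -(proj2 hclk a1 a2 a3 0%N).
have := no_coincidence (proj1 hclk) (ltW (theta0 a.2 a.1.2)) ioinj ion c1 bnd.
apply: filterS => w /eqP hw _; apply/eqP => e; apply: hw.
rewrite big_split_ord /=.
under eq_bigr do rewrite /c /io (unsplitK (inl _ : 'I_l + 'I_l'.+1)) mulN1r.
under [X in _ + X]eq_bigr do
  rewrite /c /io (unsplitK (inr _ : 'I_l + 'I_l'.+1)) mul1r.
move: e; rewrite !big_mkord => <-; rewrite big_ord_recl sumrN.
by rewrite addrCA [X in _ + X]addrC subrr addr0.
Qed.

End clocks.

(** * The height map in continuous time *)

Section continuous_time.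
Context (R : realType).

Lemma rings_at_ge (clk : nat * nat * nat * nat -> R) i n p t :
  (forall a, 0 < clk a) -> rings_at clk i n p t -> clk (i, n, p, 0%N) <= t.
Proof.
move=> clk0 [l ->]; rewrite big_mkord big_ord_recl /= lerDl.
by apply: sumr_ge0 => j _; exact: ltW.
Qed.

Lemma pure_birth_good_path (theta : nat -> nat -> R) (M : R) (x : array)
    (d : measure_display) (T : measurableType d) (P : probability T R)
    (clk : nat * nat * nat * nat -> {RV P >-> R}) :
  IAstar x -> (forall p n, 0 < theta p n) -> (forall p n, theta p n <= M) ->
  exponential_clocks theta clk ->
  {ae P, forall w, forall f, pure_birth_path (fun a => clk a w) x f -> good_path f}.
Proof.
move=> hx theta0 hM hclk.
have hb (a : nat * nat * nat) := clocks_block theta0 hclk a.1.2 a.2 hM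
  (ltr0Sn R a.1.1).
have := ae_foralln_count hb; have := clocks_gt0 theta0 hclk.
apply: filterS2 => w clk0 hw f hf.
have [hxIA _] := hx; have [hcad _ _] := hf.
split=> // [s t n k|t t0]; first exact: pure_birth_path_mono hf _ _ _ _.
have IAft := pure_birth_path_IA hf hxIA t0.
apply: IAstarP => // i.
have [N hN] := IAstar_stable_upto i hx.
(* Integer horizons keep the family of exceptional null sets countable. *)
pose K := Num.truncn t.
have tK : t <= K.+1%:R by apply/ltW; exact: truncnS_gt.
have [n hn] := hw (K, i, N).
exists (n + N + i)%N; first exact: leq_addl.
apply: (pure_birth_path_stay (tmax := K.+1%:R) hf _ _ t0 tK (leqnn i)).
  by move=> l li; apply: hN => //; rewrite -addnA addnCA leq_addr.
move=> l u li uK r; have := hn (Ordinal (li : (l < i.+1)%N)) => /=.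
by rewrite ltNge (le_trans (rings_at_ge clk0 r) uK).
Qed.

Lemma right_rat (s b : R) (Q : R -> Prop) : (\forall u \near s^'+, Q u) -> s < b ->
  exists2 q : rat, s < ratr q < b & Q (ratr q).
Proof.
rewrite near_withinE => -[e /= e0 he] sb.
have : s < Num.min b (s + e) by rewrite lt_min sb ltrDl.
move=> /rat_in_itvoo[q]; rewrite in_itv /= lt_min => /andP[sq /andP[qb qe]].
exists q; first by rewrite sq.
apply: he => //=; rewrite distrC ger0_norm ?subr_ge0 ?(ltW sq)//.
by rewrite ltrBlDl.
Qed.

(** By right-continuity every entry at time [t] is taken again at rational times just after [t]. *)
Lemma good_path_rat (f : R -> array) : cadlag f ->
  (forall q1 q2 : rat, 0 <= q1 -> q1 <= q2 -> forall n k, (k <= n)%N ->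
     (f (ratr q1) n k <= f (ratr q2) n k)%N) ->
  (forall q : rat, 0 <= q -> IAstar (f (ratr q))) -> good_path f.
Proof.
move=> hf hmono hstar; have [hr _] := hf.
have mono s t n k : 0 <= s -> s <= t -> (k <= n)%N -> (f s n k <= f t n k)%N.
  move=> s0; rewrite le_eqVlt => /predU1P[->//|st kn].
  have [q1 /andP[sq1 q1t] <-] := right_rat (hr s n k s0 kn) st.
  have t0 : 0 <= t by rewrite (le_trans s0)// ltW.
  have [q2 /andP[tq2 _] <-] := right_rat (hr t n k t0 kn) (ltr_pwDr ltr01 (lexx t)).
  apply: hmono => //; first by rewrite -(ler_rat R) rmorph0 (le_trans s0)// ltW.
  by rewrite -(ler_rat R) (le_trans (ltW q1t))// ltW.
split=> // t t0.
have pos q : t < ratr q -> 0 <= q.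
  by move=> tq; rewrite -(ler_rat R) rmorph0 (le_trans t0)// ltW.
have t1 : t < t + 1 by rewrite ltrDl.
have IAft : IA (f t).
  apply/IA_uptoP => N.
  have := near_levels (F := t^'+) (z := f t) N (fun n k kn => hr t n k t0 kn).
  move=> hN; have [q /andP[tq _] hq] := right_rat (hN _) t1.
  have [IAq _] := hstar q (pos q tq).
  exact: IA_upto_eq hq (iffLR (IA_uptoP _) IAq N).
apply: IAstarP => // i.
have [q] := rat_in_itvoo t1; rewrite in_itv /= => /andP[tq _].
have [n i_n hn] := IAstar_stable (hstar q (pos q tq)) i.
exists n => //; apply/eqP; rewrite eqn_leq IA_ge// andbT -[leqRHS](hn n (leqnn n)).
exact: mono (ltW tq) i_n.
Qed.

Lemma ae_eq_law (S : Type) (D : set S) (d d' : measure_display)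
    (T : measurableType d) (T' : measurableType d')
    (P : probability T R) (X : S -> T -> array)
    (P' : probability T' R) (X' : S -> T' -> array) (C : set (path_space D)) :
  eq_law D P X P' X' -> measurable C ->
  {ae P', forall w, C (X'^~ w)} -> {ae P, forall w, C (X^~ w)}.
Proof.
move=> h mC; have [mX mX' _] := h.
have mCX : measurable [set w | C (X^~ w)].
  by have := measurable_path_map mX measurableT mC; rewrite setTI.
have mCX' : measurable [set w | C (X'^~ w)].
  by have := measurable_path_map mX' measurableT mC; rewrite setTI.
move=> /(aeP P' mCX') e; apply/(aeP P mCX).
by rewrite (eq_law_path h mC).
Qed.

(** [X] is tied to the clocks only through its law, which can be tested at countably many times; its
    own cadlag property extends the conclusion from rational times to all times. *)
Lemma good_path_law (d d' : measure_display)
    (T : measurableType d) (T' : measurableType d')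
    (P : probability T R) (X : R -> T -> array)
    (P' : probability T' R) (X' : R -> T' -> array) :
  eq_law [set t | 0 <= t] P X P' X' ->
  {ae P, forall w, cadlag (X^~ w)} -> {ae P', forall w, good_path (X'^~ w)} ->
  {ae P, forall w, good_path (X^~ w)}.
Proof.
move=> h hX hX'.
pose Om := path_space [set t : R | 0 <= t].
have q0 (q : rat) : 0 <= q -> 0 <= ratr q :> R by rewrite ler0q.
have fib (q : rat) n k : 0 <= q -> (k <= n)%N -> fiber_measurable (fun f : Om => f (ratr q) n k).
  by move=> /q0 hq kn; exact: fiber_path.
have mono : {ae P, forall w, forall a : rat * rat * nat * nat,
    0 <= a.1.1.1 -> a.1.1.1 <= a.1.1.2 -> (a.2 <= a.1.2)%N ->
    (X (ratr a.1.1.1) w a.1.2 a.2 <= X (ratr a.1.1.2) w a.1.2 a.2)%N}.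
  apply: ae_foralln_count => -[[[q1 q2] n] k] /=.
  apply: (ae_eq_law (C := [set f : Om | 0 <= q1 -> q1 <= q2 -> (k <= n)%N ->
    (f (ratr q1) n k <= f (ratr q2) n k)%N]) h).
    apply: measurable_imply => q10; apply: measurable_imply => q12.
    apply: measurable_imply => kn.
    have q20 := le_trans q10 q12.
    exact: (fiber_comp2 leq (fib q1 n k q10 kn) (fib q2 n k q20 kn) true).
  apply: filterS hX' => w [_ hm _] /= q10 q12 kn.
  by apply: hm; rewrite ?q0 ?ler_rat.
(* [IAstar] is restated with countable quantifiers to be an event of path space. The repeated guard
   [i <= n] is there because only such entries are measurable. *)
pose star (z : array) := (forall a : nat * nat, (a.2 <= a.1)%N ->
  (z a.1.+1 a.2 <= z a.1 a.2)%N /\ (z a.1 a.2 < z a.1.+1 a.2.+1)%N) /\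
  forall i, exists n, (i <= n)%N /\ ((i <= n)%N -> z n i = i).
have starP z : star z <-> IAstar z.
  split=> [[h1 h2]|hz].
    apply: IAstarP => [n k|i]; first exact: (h1 (n, k)).
    by have [n [i_n hn]] := h2 i; exists n => //; exact: hn.
  split=> [[n k] /=|i]; first by case: hz => hz _; exact: hz.
  by have [n i_n hn] := IAstar_stable hz i; exists n; split=> // _; exact: hn.
have hstar : {ae P, forall w, forall q : rat, 0 <= q -> star (X (ratr q) w)}.
  apply: ae_foralln_count => q.
  apply: (ae_eq_law (C := [set f : Om | 0 <= q -> star (f (ratr q))]) h).
    apply: measurable_imply => hq; apply: measurableI.
      apply: measurable_forall_count => -[n k]; apply: measurable_imply => kn /=.
      apply: measurableI.
        exact: (fiber_comp2 leq (fib q n.+1 k hq (leqW kn)) (fib q n k hq kn) true).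
      exact: (fiber_comp2 (fun a b => a < b)%N (fib q n k hq kn) (fib q n.+1 k.+1 hq kn) true).
    apply: measurable_forall_count => i; apply: measurable_exists_count => n.
    apply: measurableI; first exact: measurable_prop.
    by apply: measurable_imply => i_n; exact: fib.
  by apply: filterS hX' => w [_ _ hs] /= hq; apply/starP; apply: hs; exact: q0.
apply: filterS3 hX mono hstar => w h1 h2 h3.
apply: good_path_rat => // [q1 q2 hq1 hq2 n k kn|q hq].
  exact: (h2 (q1, q2, n, k)).
by apply/starP; exact: h3.
Qed.

Lemma pure_birth_Hgt (theta : nat -> nat -> R) (M : R) (x : array)
    (d : measure_display) (T : measurableType d) (P : probability T R)
    (X : R -> T -> array) :
  IAstar x -> (forall p n, 0 < theta p n) -> (forall p n, theta p n <= M) ->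
  pure_birth theta x P X ->
  pure_birth (env_swap theta) (Hgt x) P (fun t w => Hgt (X t w)).
Proof.
move=> hx theta0 hM [cadX [d' [T' [P' [clk [Y [hclk hY law]]]]]]].
have goodY : {ae P', forall w, good_path (Y^~ w)}.
  have := pure_birth_good_path hx theta0 hM hclk.
  by apply: filterS2 hY => w hw; apply.
split.
  apply: filterS (good_path_law law cadX goodY) => w hw.
  exact: (cadlag_Hgt hw).
pose clk' (a : nat * nat * nat * nat) : {RV P' >-> R} :=
  clk (a.1.1.1, a.1.2, a.1.1.2, a.2).
exists d', T', P', clk', (fun t w => Hgt (Y t w)); split.
- split; last by move=> i n p l A mA; exact: (proj2 hclk).
  apply: (mutually_independent_map (proj1 hclk)
    (iota := fun a => (a.1.1.1, a.1.2, a.1.1.2, a.2)) (g := fun _ => id)) => //.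
  by move=> [[[i n] p] l] [[[i' n'] p'] l'] [-> -> -> ->].
- apply: filterS3 (clocks_no_coincidence theta0 hclk) hY goodY => w h3 h1 h2.
  have := pure_birth_path_Hgt h3 h2 h1.
  congr (pure_birth_path _ _ _); apply/funext => -[[[i n] p] l] //.
- exact: eq_law_Hgt.
Qed.

End continuous_time.

Lemma env_sup_attained_bound (R : realType) (theta : nat -> nat -> R) :
  (env_sup theta < +oo)%E ->
  exists2 c, env_sup theta = c%:E & forall p n, theta p n <= c.
Proof.
move=> hsup.
have le p n : ((theta p n)%:E <= env_sup theta)%E.
  by apply: ereal_sup_ubound; exists (p, n).
have fin : env_sup theta \is a fin_num.
  by rewrite fin_numE (lt_eqF hsup) andbT gt_eqF// (lt_le_trans _ (le 0%N 0%N))// ltNyr.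
exists (fine (env_sup theta)); first by rewrite fineK.
by move=> p n; rewrite -lee_fin fineK.
Qed.

Theorem theorem2p44 (R : realType) (x : array) (theta : nat -> nat -> R)
    (d : measure_display) (T : measurableType d) (P : probability T R)
    (hx : IAstar x) (htheta : forall a n, 0 < theta a n)
    (hinf : (0 < env_inf theta)%E) :
  [/\ (env_sup theta < +oo)%E ->
      forall X : R -> T -> array,
        pure_birth theta x P X ->
        pure_birth (env_swap theta) (Hgt x) P (fun t w => Hgt (X t w)),
      (env_sup theta < 1)%E ->
      forall X : nat -> T -> array,
        sequential_bernoulli theta x P X ->
        warren_windridge_geometric (env_swap theta) (Hgt x) P
          (fun t w => Hgt (X t w)) &
      (env_sup theta < 1)%E ->
      forall X : nat -> T -> array,
        warren_windridge_geometric theta x P X ->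
        sequential_bernoulli (env_swap theta) (Hgt x) P
          (fun t w => Hgt (X t w))].
Proof.
split=> hsup X hX.
- have [M _ hM] := env_sup_attained_bound hsup.
  exact: pure_birth_Hgt hx htheta hM hX.
- have [c cE hc] := env_sup_attained_bound (lt_trans hsup (ltry _)).
  by apply: (sequential_bernoulli_Hgt hx _ hc hX); rewrite -lte_fin -cE.
- have [c cE hc] := env_sup_attained_bound (lt_trans hsup (ltry _)).
  by apply: (warren_windridge_geometric_Hgt hx _ hc hX); rewrite -lte_fin -cE.
Qed.
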